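(* For every positive integer $\ell$ there exists an integer $g_\ell$ such that for all $g \geq g_\ell$, every abelian variety $X$ of dimension $g$, and every integer $n$ with $0 \leq n \leq \ell$, the following are equivalent: (1) $\rho(X) \in R_{g,n}$; (2) $X$ is isogenous to $E^{g-n} \times A_n$, where $E$ is an elliptic curve with complex multiplication, $A_n$ is an abelian variety of dimension $n$, and $\operatorname{Hom}(E, A_n) = 0$.
   Context: Abelian varieties (in particular elliptic curves) are over the field $\mathbb{C}$ of complex numbers. The Picard number $\rho(A)$ of an abelian variety $A$ is the rank of its Néron–Severi group $\operatorname{NS}(A)$. For $g \geq 1$, $R_g$ denotes the set of all integers $\rho$ such that there exists an abelian variety $A$ of dimension $g$ with $\rho(A) = \rho$; by convention $R_0 = \{0\}$ (the $0$-dimensional abelian variety is a point). For integers $0 \leq n \leq g$ set \[ R_{g,n} := \{ (g-n)^2 + x \mid x \in R_n \}. \] *)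

(* Defs.v *)
From HB Require Import structures.
From mathcomp Require Import all_boot all_order all_algebra.
From mathcomp Require Import complex.
From mathcomp Require Import all_classical all_reals.

Set Implicit Arguments.
Unset Strict Implicit.
Unset Printing Implicit Defensive.

Import Order.TTheory GRing.Theory Num.Theory.
Local Open Scope classical_set_scope.
Local Open Scope ring_scope.

(* Vectors are rows: a C-linear map C^g -> C^h is a matrix F : 'M_(g, h)
   acting by v |-> v *m F. *)

Definition is_lattice (R : realType) (g : nat) (L : set 'rV[R[i]]_g) : Prop :=
  exists (m : nat) (P : 'M[R[i]]_(m, g)),
    bijective (fun c : 'rV[R]_m => map_mx (real_complex R) c *m P) /\
    L = [set map_mx intr z *m P | z in [set: 'rV[int]_m]].

(* The Neron-Severi group of the complex torus C^g / L.  By the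
   Appell-Humbert theorem, c_1 identifies Pic / Pic^0 with the group of
   Hermitian forms on C^g whose imaginary part is integral on L
   (equivalently, with the classes of type (1,1) in
   H^2(C^g / L, Z) = Alt^2(L, Z)).  [form Num.conj H u v] is
   u *m H *m v^*, linear in u and antilinear in v. *)
Definition neron_severi (R : realType) (g : nat) (L : set 'rV[R[i]]_g) :
    set 'M[R[i]]_g :=
  [set H | H \is hermsymmx /\
     forall u v, L u -> L v ->
       complex.Im (form Num.conj H u v) \is a Num.int].

Definition polarization (R : realType) (g : nat) (L : set 'rV[R[i]]_g)
    (H : 'M[R[i]]_g) : Prop :=
  neron_severi L H /\ forall u, u != 0 -> 0 < form Num.conj H u u.

(* A g-dimensional abelian variety over C, as a polarizable complex torus
   C^g / L. *)
Record abvar (R : realType) (g : nat) := AbVar {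
  lattice : set 'rV[R[i]]_g;
  lattice_is_lattice : is_lattice lattice;
  lattice_polarizable : exists H, polarization lattice H
}.

Definition Zfree (V : zmodType) (k : nat) (v : 'I_k -> V) : Prop :=
  forall c : 'I_k -> int, \sum_i v i *~ c i = 0 -> forall i, c i = 0.

Definition is_Zrank (V : zmodType) (S : set V) (r : nat) : Prop :=
  forall k, (exists v : 'I_k -> V, (forall i, S (v i)) /\ Zfree v)
            <-> (k <= r)%N.

(* The default value 0 only concerns subgroups of infinite rank. *)
Definition Zrank (V : zmodType) (S : set V) : nat := xget 0%N (is_Zrank S).

Definition picard_number (R : realType) (g : nat) (A : abvar R g) : nat :=
  Zrank (neron_severi (lattice A)).

(* A homomorphism of complex tori C^g / L -> C^h / L' lifts uniquely to a
   C-linear map C^g -> C^h carrying L into L' (its analytic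
   representation), with which it is identified; addition and composition
   are those of matrices. *)
Definition abvar_hom (R : realType) (g h : nat) (A : abvar R g) (B : abvar R h) :
    set 'M[R[i]]_(g, h) :=
  [set F | forall u, lattice A u -> lattice B (u *m F)].

(* Surjectivity and finiteness of the kernel are those of the induced map
   C^g / L -> C^h / L'. *)
Definition isogeny (R : realType) (g h : nat) (A : abvar R g) (B : abvar R h)
    (F : 'M[R[i]]_(g, h)) : Prop :=
  [/\ abvar_hom A B F,
      forall w, exists v, lattice B (v *m F - w) &
      exists s : seq 'rV[R[i]]_g, forall v, lattice B (v *m F) ->
        exists2 t, t \in s & lattice A (v - t)].

Definition isogenous (R : realType) (g h : nat) (A : abvar R g)
    (B : abvar R h) : Prop :=
  exists F, isogeny A B F.

(* For an elliptic curve E: End(E) is strictly larger than Z. *)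
Definition has_CM (R : realType) (E : abvar R 1) : Prop :=
  exists2 F, abvar_hom E E F & forall k : int, F <> k%:~R%:M.

Section Products.
Variable R : realType.

Lemma point_is_lattice : is_lattice [set: 'rV[R[i]]_0].
Proof.
exists 0%N, 0; split.
  by exists (fun=> 0) => v; rewrite ?[LHS]thinmx0 ?[RHS]thinmx0.
by apply/seteqP; split => // v _; exists 0; rewrite // [RHS]thinmx0 mulmx0.
Qed.

Lemma point_polarizable : exists H, polarization [set: 'rV[R[i]]_0] H.
Proof.
exists 0; split; first split.
- by apply/is_hermitianmxP/matrixP => -[].
- by move=> u v _ _; rewrite /form mulmx0 mul0mx mxE /= rpred0.
- by move=> u; rewrite thinmx0 eqxx.
Qed.

Definition abvar_point : abvar R 0 := AbVar point_is_lattice point_polarizable.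

Definition prod_lattice (g h : nat) (L : set 'rV[R[i]]_g)
    (L' : set 'rV[R[i]]_h) : set 'rV[R[i]]_(g + h) :=
  [set w | L (lsubmx w) /\ L' (rsubmx w)].

Lemma prod_is_lattice g h (L : set 'rV[R[i]]_g) (L' : set 'rV[R[i]]_h) :
  is_lattice L -> is_lattice L' -> is_lattice (prod_lattice L L').
Proof.
move=> [m [P [[p pK Kp] ->]]] [n [Q [[q qK Kq] ->]]].
exists (m + n)%N, (block_mx P 0 0 Q); split.
  exists (fun w => row_mx (p (lsubmx w)) (q (rsubmx w))) => c.
    rewrite -[c]hsubmxK map_row_mx mul_row_block !mulmx0 addr0 add0r.
    by rewrite row_mxKl row_mxKr pK qK.
  rewrite map_row_mx mul_row_block !mulmx0 addr0 add0r.
  by rewrite Kp Kq hsubmxK.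
apply/seteqP; split => w.
  move=> [[z _ zE] [t _ tE]]; exists (row_mx z t) => //.
  by rewrite map_row_mx mul_row_block !mulmx0 addr0 add0r zE tE hsubmxK.
move=> [c _ <-]; rewrite -[c]hsubmxK map_row_mx mul_row_block !mulmx0 addr0.
rewrite add0r; split; rewrite ?row_mxKl ?row_mxKr.
  by exists (lsubmx c).
by exists (rsubmx c).
Qed.

Lemma form_block g h (H : 'M[R[i]]_g) (K : 'M[R[i]]_h) u v :
  form Num.conj (block_mx H 0 0 K) u v =
  form Num.conj H (lsubmx u) (lsubmx v) + form Num.conj K (rsubmx u) (rsubmx v).
Proof.
rewrite /form -{1}[u]hsubmxK -{1}[v]hsubmxK mul_row_block !mulmx0 addr0 add0r.
by rewrite tr_row_mx map_col_mx mul_row_col mxE.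
Qed.

Lemma prod_polarizable g h (L : set 'rV[R[i]]_g) (L' : set 'rV[R[i]]_h) :
  (exists H, polarization L H) -> (exists H, polarization L' H) ->
  exists H, polarization (prod_lattice L L') H.
Proof.
move=> [H [[Hh Hi] Hp]] [K [[Kh Ki] Kp]].
exists (block_mx H 0 0 K); split; first split.
- apply/is_hermitianmxP.
  move/is_hermitianmxP: Hh; move/is_hermitianmxP: Kh.
  rewrite !expr0 !scale1r => KE HE.
  by rewrite tr_block_mx map_block_mx -HE -KE !trmx0 !map_mx0.
- move=> u v [uL uL'] [vL vL']; rewrite form_block.
  by rewrite raddfD /= rpredD ?Hi ?Ki.
- have nn n (M : 'M[R[i]]_n) : (forall u, u != 0 -> 0 < form Num.conj M u u) ->
    forall u, 0 <= form Num.conj M u u.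
    move=> Mp u; have [->|/Mp/ltW//] := eqVneq u 0.
    by rewrite /form !mul0mx mxE.
  move=> u u0; rewrite form_block.
  have [l0|l0] := eqVneq (lsubmx u) 0.
    rewrite ltr_wpDl ?nn// Kp//; apply: contra_neq u0 => r0.
    by rewrite -[u]hsubmxK l0 r0 row_mx0.
  by rewrite ltr_pwDl ?nn// Hp.
Qed.

Definition abvar_prod (g h : nat) (A : abvar R g) (B : abvar R h) :
    abvar R (g + h) :=
  AbVar (prod_is_lattice (lattice_is_lattice A) (lattice_is_lattice B))
        (prod_polarizable (lattice_polarizable A) (lattice_polarizable B)).

Fixpoint elliptic_pow (E : abvar R 1) (k : nat) : abvar R k :=
  if k is k'.+1 then abvar_prod E (elliptic_pow E k') else abvar_point.

End Products.

Definition picard_numbers (R : realType) (g : nat) : set nat :=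
  if g is 0 then [set 0%N] else [set picard_number A | A in [set: abvar R g]].

(* Meant for n <= g. *)
Definition shifted_picard_numbers (R : realType) (g n : nat) : set nat :=
  [set ((g - n) ^ 2 + x)%N | x in picard_numbers R n].

(* Main.v *)
(* A complex torus C^g / L is encoded, up to isogeny, by the real matrix J of
   multiplication by i in a basis of L: homomorphisms are the rational
   matrices Z with Z J' = J Z, and Neron-Severi classes the rational
   alternating N with J N J^T = N.  Choosing a simple abelian subvariety B
   and applying Poincare reducibility, X is isogenous to B x Y and
     rho(X) = rho(B) + rho(Y) + rk Hom(B, Y).
   Evaluating homomorphisms at one nonzero lattice vector of a simple B gives
   rk Hom(B, Y) <= 2 dim Y and rho(B) <= 2 dim B, while for an elliptic curve
   B without complex multiplication rk Hom(B, Y) is the multiplicity of B in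
   Y, hence at most dim Y.  By induction rho(X) <= g^2, and
   rho(X) <= g^2 / 2 + g + kappa g whenever every CM elliptic curve E has
   rk Hom(E, X) <= kappa.  With kappa = g / 4 the latter is smaller than
   (g - n)^2 for g large.  So if rho(X) lies in R_{g,n}, then X ~ E^K x A with
   E a CM curve, Hom(E, A) = 0 and K > g / 8, and the equality
   rho(X) = K^2 + rho(A) with rho(A) <= (g - K)^2 forces K = g - n.  The
   converse is the additivity of rho together with rho(E^k) = k^2. *)
Require Import Defs.
From HB Require Import structures.
From mathcomp Require Import all_boot all_order all_algebra.
From mathcomp Require Import complex.
From mathcomp Require Import all_classical all_reals.
From mathcomp Require Import zify ring lra.

Set Implicit Arguments.
Unset Strict Implicit.
Unset Printing Implicit Defensive.

Import Order.TTheory GRing.Theory Num.Theory.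
Local Open Scope classical_set_scope.
Local Open Scope ring_scope.

(** * Rational subspaces *)

Section Subspaces.
Variable K : fieldType.

(** Among the subspaces contained in [S], one of maximal dimension is all of [S]: adjoining the line
    of a further element would stay inside [S]. *)
Lemma subspace_vspace (V : vectType K) (S : V -> Prop) :
  S 0 -> (forall a u v, S u -> S v -> S (a *: u + v)) ->
  exists U : {vspace V}, forall x, x \in U <-> S x.
Proof.
move=> S0 SD.
pose good d := `[< exists U : {vspace V}, \dim U = d /\ {in U, forall x, S x} >].
have exg : exists d, good d.
  exists 0%N; apply/asboolP; exists 0%VS; split; first exact: dimv0.
  by move=> x; rewrite memv0 => /eqP ->.
have leg d : good d -> (d <= dim V)%N.
  by move=> /asboolP[U [<- _]]; rewrite -dimvf dimvS ?subvf.
case: (ex_maxnP exg leg) => d /asboolP[U [dU US]] dmax.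
exists U => x; split; first exact: US.
move=> Sx; apply: contraT => xU.
suff /dmax : good (\dim (<[x]> + U)%VS).
  rewrite -dU leqNgt => /negP[].
  rewrite ltn_neqAle dimvS ?addvSr// andbT.
  rewrite (dimv_leqif_eq (addvSr <[x]> U)).
  apply: contraNneq xU => ->; exact: (subvP (addvSl _ _) _ (memv_line x)).
apply/asboolP; exists (<[x]> + U)%VS; split => // _ /memv_addP[u /vlineP[a ->] [v vU ->]].
by apply: SD => //; apply: US.
Qed.

Lemma dim_surj (V W : vectType K) (f : {linear V -> W})
    (U : {vspace V}) (U' : {vspace W}) :
  {in U, forall u, f u \in U'} ->
  (forall w, w \in U' -> exists2 u, u \in U & f u = w) ->
  \dim U = (\dim (U :&: lker (linfun f))%VS + \dim U')%N.
Proof.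
move=> fU Uf; rewrite -(limg_ker_dim (linfun f) U); congr (_ + \dim _)%N.
apply/vspaceP => w; apply/memv_imgP/idP.
  by move=> [u uU ->]; rewrite lfunE fU.
by move=> /Uf[u uU <-]; exists u; rewrite ?lfunE.
Qed.

Lemma dim_inj (V W : vectType K) (f : {linear V -> W})
    (U : {vspace V}) (U' : {vspace W}) :
  {in U, forall u, f u \in U'} -> {in U, forall u, f u = 0 -> u = 0} ->
  (\dim U <= \dim U')%N.
Proof.
move=> fU f0; rewrite -(@limg_dim_eq _ _ _ (linfun f) U).
  by apply/dimvS/subvP => _ /memv_imgP[u uU ->]; rewrite lfunE fU.
apply/eqP; rewrite -subv0; apply/subvP => u.
by rewrite memv_cap memv_ker lfunE memv0 => /andP[uU /eqP/(f0 _ uU)->].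
Qed.

Lemma dim_bij (V W : vectType K) (f : {linear V -> W})
    (U : {vspace V}) (U' : {vspace W}) :
  {in U, forall u, f u \in U'} -> {in U, forall u, f u = 0 -> u = 0} ->
  (forall w, w \in U' -> exists2 u, u \in U & f u = w) ->
  \dim U = \dim U'.
Proof.
move=> fU f0 Uf; rewrite (dim_surj fU Uf).
suff -> : (U :&: lker (linfun f) = 0)%VS by rewrite dimv0.
apply/eqP; rewrite -subv0; apply/subvP => u.
by rewrite memv_cap memv_ker lfunE memv0 => /andP[uU /eqP/(f0 _ uU)->].
Qed.

End Subspaces.

(** * Rational homomorphisms of complex structures *)

Section ComplexStructures.
Variable R : realFieldType.
Local Notation "A ^R" := (map_mx (ratr : rat -> R) A) (at level 2, format "A ^R").

Definition cplx_structure m (J : 'M[R]_m) : Prop := J *m J = - 1%:M.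

Definition Qhom m n (J : 'M[R]_m) (J' : 'M[R]_n) (Z : 'M[rat]_(m, n)) : Prop :=
  Z^R *m J' = J *m Z^R.

Definition Qns m (J : 'M[R]_m) (N : 'M[rat]_m) : Prop :=
  N^T = - N /\ J *m N^R *m J^T = N^R.

(** In lattice coordinates, [c *m J *m N^R *m c^T] is N(ic, c), the value at c of the Hermitian form
    with imaginary part N. *)
Definition Qpolarization m (J : 'M[R]_m) (N : 'M[rat]_m) : Prop :=
  Qns J N /\ forall c : 'rV[R]_m, c != 0 -> 0 < (c *m J *m N^R *m c^T) 0 0.

Definition polarizable m (J : 'M[R]_m) : Prop := exists N, Qpolarization J N.

Definition dsum m n (J : 'M[R]_m) (J' : 'M[R]_n) : 'M[R]_(m + n) :=
  block_mx J 0 0 J'.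

(** Two rank conditions express invertibility without requiring [m] and [n] to be syntactically
    equal. *)
Definition Qisog m n (J : 'M[R]_m) (J' : 'M[R]_n) : Prop :=
  exists Z, [/\ Qhom J J' Z, row_free Z & row_full Z].

Fact Qhom_vspace m n (J : 'M[R]_m) (J' : 'M[R]_n) :
  exists U : {vspace 'M[rat]_(m, n)}, forall Z, Z \in U <-> Qhom J J' Z.
Proof.
apply: subspace_vspace => [|a u v]; rewrite /Qhom.
  by rewrite map_mx0 mul0mx mulmx0.
move=> hu hv; rewrite map_mxD map_mxZ mulmxDl mulmxDr -scalemxAl hu hv.
by rewrite scalemxAr.
Qed.

Fact Qns_vspace m (J : 'M[R]_m) :
  exists U : {vspace 'M[rat]_m}, forall N, N \in U <-> Qns J N.
Proof.
apply: subspace_vspace => [|a u v].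
  by split; rewrite ?trmx0 ?oppr0 // map_mx0 mulmx0 mul0mx.
move=> [uT hu] [vT hv]; split.
  by rewrite linearD linearZ /= uT vT scalerN opprD.
rewrite map_mxD map_mxZ mulmxDr mulmxDl -scalemxAr -scalemxAl.
by rewrite hu hv.
Qed.

Definition homV m n (J : 'M[R]_m) (J' : 'M[R]_n) := projT1 (cid (Qhom_vspace J J')).
Definition nsV m (J : 'M[R]_m) := projT1 (cid (Qns_vspace J)).

Lemma homVP m n (J : 'M[R]_m) (J' : 'M[R]_n) Z : Z \in homV J J' <-> Qhom J J' Z.
Proof. by rewrite /homV; case: cid => U /= ->. Qed.

Lemma nsVP m (J : 'M[R]_m) N : N \in nsV J <-> Qns J N.
Proof. by rewrite /nsV; case: cid => U /= ->. Qed.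

Lemma Qhom_comp m n p (J : 'M[R]_m) (J' : 'M[R]_n) (J'' : 'M[R]_p) Z Z' :
  Qhom J J' Z -> Qhom J' J'' Z' -> Qhom J J'' (Z *m Z').
Proof.
by rewrite /Qhom => h h'; rewrite map_mxM -mulmxA h' !mulmxA h.
Qed.

Lemma Qisog_size m n (J : 'M[R]_m) (J' : 'M[R]_n) : Qisog J J' -> m = n.
Proof.
move=> [Z [_ /eqP h /eqP h']]; exact: (etrans (esym h) h').
Qed.

Lemma Qisog_sym m n (J : 'M[R]_m) (J' : 'M[R]_n) : Qisog J J' -> Qisog J' J.
Proof.
move=> h; have e := Qisog_size h; case: n / e J' h => J' [Z [ZJ]].
rewrite row_free_unit => Zu _; exists (invmx Z).
rewrite row_free_unit row_full_unit unitmx_inv; split => //.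
have Zu' : Z^R \in unitmx by rewrite map_unitmx.
rewrite /Qhom map_invmx; apply: (can_inj (mulKmx Zu')).
by rewrite mulKVmx // mulmxA ZJ mulmxK.
Qed.

Lemma Qisog_trans m n p (J : 'M[R]_m) (J' : 'M[R]_n) (J'' : 'M[R]_p) :
  Qisog J J' -> Qisog J' J'' -> Qisog J J''.
Proof.
move=> h h'; have e := Qisog_size h; have e' := Qisog_size h'.
case: p / e' J'' h'; case: n / e J' h => J' [Z [ZJ Zf _]] J'' [Z' [ZJ' Zf' _]].
exists (Z *m Z'); split; first exact: Qhom_comp ZJ ZJ'.
  by move: Zf Zf'; rewrite !row_free_unit unitmx_mul => -> ->.
by move: Zf Zf'; rewrite row_full_unit !row_free_unit unitmx_mul => -> ->.
Qed.

Lemma Qisog_refl m (J : 'M[R]_m) : Qisog J J.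
Proof.
exists 1%:M; rewrite row_free_unit row_full_unit unitmx1; split => //.
by rewrite /Qhom map_mx1 mul1mx mulmx1.
Qed.

Lemma Qisog_dsum m n m' n' (J : 'M[R]_m) (J' : 'M[R]_n) (I : 'M[R]_m') (I' : 'M[R]_n') :
  Qisog J J' -> Qisog I I' -> Qisog (dsum J I) (dsum J' I').
Proof.
move=> h h'; have e := Qisog_size h; have e' := Qisog_size h'.
case: n / e J' h => J' [Z [ZJ Zf _]]; case: n' / e' I' h' => I' [Z' [ZJ' Zf' _]].
have u : block_mx Z 0 0 Z' \in unitmx.
  move: Zf Zf'; rewrite !row_free_unit !unitmxE det_ublock unitrM.
  by move=> -> ->.
exists (block_mx Z 0 0 Z'); rewrite row_free_unit row_full_unit; split => //.
rewrite /Qhom /dsum map_block_mx !map_mx0 !mulmx_block.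
by rewrite !mulmx0 !mul0mx !addr0 !add0r ZJ ZJ'.
Qed.

Lemma Qisog_dsumA m n p (J : 'M[R]_m) (J' : 'M[R]_n) (J'' : 'M[R]_p) :
  Qisog (dsum (dsum J J') J'') (dsum J (dsum J' J'')).
Proof.
exists (castmx (erefl _, esym (addnA m n p)) 1%:M).
have e : forall q (e : (m + n + p = q)%N),
  let Z : 'M[rat]_(_, _) := castmx (erefl _, e) 1%:M in row_free Z /\ row_full Z.
  move=> q; case: q / => /=; rewrite castmx_id row_free_unit row_full_unit unitmx1.
  by [].
have [? ?] := e _ (esym (addnA m n p)); split => //.
rewrite /Qhom map_castmx map_mx1.
have -> : dsum J (dsum J' J'') =
    castmx (esym (addnA m n p), esym (addnA m n p)) (dsum (dsum J J') J'').
  rewrite /dsum -[X in block_mx _ X _ _]row_mx0 -[X in block_mx _ _ X _]col_mx0.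
  by rewrite block_mxA row_mx0 col_mx0; congr castmx; congr (_, _); apply: eq_irrelevance.
rewrite /dsum; case: (m + (n + p))%N / (esym (addnA m n p)) => /=.
by rewrite !castmx_id mul1mx mulmx1.
Qed.

End ComplexStructures.

(** * Additivity of the ranks of NS and Hom, and their invariance under isogeny *)

Section Additivity.
Variable R : realFieldType.
Local Notation "A ^R" := (map_mx (ratr : rat -> R) A) (at level 2, format "A ^R").

(** Since J^-1 = -J, invariance of N under J means that J is skew-adjoint for N. *)
Lemma QnsE m (J : 'M[R]_m) (N : 'M[rat]_m) : cplx_structure J ->
  J *m N^R *m J^T = N^R <-> J *m N^R = - (N^R *m J^T).
Proof.
move=> JJ; have JT : J^T *m J^T = - 1%:M by rewrite -trmx_mul JJ linearN /= trmx1.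
split=> [h|->]; first by rewrite -[in RHS]h -!mulmxA JT !mulmxN mulmx1 opprK.
by rewrite mulNmx -mulmxA JT mulmxN mulmx1 opprK.
Qed.

(** By skew-adjointness c J N c^T = -(c N) J^T c^T, which vanishes if c N = 0; positivity then
    forces c = 0. *)
Lemma polarization_unit m (J : 'M[R]_m) N :
  cplx_structure J -> Qpolarization J N -> N \in unitmx.
Proof.
move=> JJ [[_ /(QnsE _ JJ) NJ] Npos].
rewrite -row_free_unit -(row_free_map (ratr : {rmorphism rat -> R})).
apply: inj_row_free => v vN0; have [//|v0] := eqVneq v 0.
have := Npos v v0.
by rewrite -(mulmxA v) NJ mulmxN mulmxA vN0 mul0mx oppr0 mul0mx mxE ltxx.
Qed.

Lemma cplx_structure_dsum m n (J : 'M[R]_m) (J' : 'M[R]_n) :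
  cplx_structure J -> cplx_structure J' -> cplx_structure (dsum J J').
Proof.
move=> h h'; rewrite /cplx_structure /dsum mulmx_block !mulmx0 !mul0mx !addr0 !add0r h h'.
by rewrite -[X in block_mx _ X]oppr0 -[X in block_mx _ _ X]oppr0 -opp_block_mx -scalar_mx_block.
Qed.

Lemma Qns_block m n (J : 'M[R]_m) (J' : 'M[R]_n) A B C D :
  Qns (dsum J J') (block_mx A B C D) <->
  [/\ Qns J A, Qns J' D, C = - B^T & J *m B^R *m J'^T = B^R].
Proof.
rewrite /Qns /dsum tr_block_mx opp_block_mx !map_block_mx tr_block_mx.
rewrite !mulmx_block !trmx0 !(mul0mx, mulmx0, addr0, add0r).
split.
  move=> [/eq_block_mx[-> CB _ ->] /eq_block_mx[-> hB _ ->]]; split => //.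
  by rewrite -[C]trmxK CB linearN.
move=> [[-> ->] [-> ->] -> hB]; split; first by rewrite linearN /= trmxK opprK.
rewrite hB; congr (block_mx _ _ _ _).
rewrite map_mxN -map_trmx mulmxN mulNmx; congr (- _).
by rewrite -[in RHS]hB !trmx_mul trmxK mulmxA.
Qed.

(** The diagonal blocks of a class on the product are classes on the factors. The upper right block
    B determines the lower left one, and B N^-1 is a homomorphism from J to J', because the
    polarization N identifies J' with its dual. *)
Lemma dim_ns_dsum m n (J : 'M[R]_m) (J' : 'M[R]_n) :
  cplx_structure J -> cplx_structure J' -> polarizable J' ->
  \dim (nsV (dsum J J')) = (\dim (nsV J) + \dim (nsV J') + \dim (homV J J'))%N.
Proof.
move=> JJ JJ' [N NP]; have Nu := polarization_unit JJ' NP.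
have [[NT NJ] _] := NP.
have blk (M : 'M[rat]_(m + n)) : M = block_mx (ulsubmx M) (ursubmx M) (dlsubmx M) (drsubmx M).
  by rewrite submxK.
rewrite (@dim_surj _ _ _
  (lsubmx \o usubmx : {linear 'M_(m + n, m + n) -> 'M_(m, m)}) _ (nsV J)); last first.
- move=> A /nsVP hA; exists (block_mx A 0 0 0); last exact: block_mxKul.
  apply/nsVP/Qns_block; split => //; last by rewrite map_mx0 mulmx0 mul0mx.
    by apply/nsVP; rewrite mem0v.
  by rewrite trmx0 oppr0.
- by move=> M /nsVP; rewrite {1}[M]blk => /Qns_block[/nsVP].
rewrite addnC -addnA; congr (_ + _)%N.
set U := (_ :&: _)%VS.
have UP M : M \in U <-> Qns (dsum J J') M /\ ulsubmx M = 0.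
  rewrite memv_cap memv_ker lfunE /= -/(ulsubmx M); split.
    by move=> /andP[/nsVP ? /eqP].
  by move=> [/nsVP-> ->]; rewrite eqxx.
rewrite (@dim_surj _ _ _
  (rsubmx \o dsubmx : {linear 'M_(m + n, m + n) -> 'M_(n, n)}) _ (nsV J')); last first.
- move=> A /nsVP hA; exists (block_mx 0 0 0 A); last exact: block_mxKdr.
  apply/UP; split; last exact: block_mxKul.
  apply/Qns_block; split => //; last by rewrite map_mx0 mulmx0 mul0mx.
    by apply/nsVP; rewrite mem0v.
  by rewrite trmx0 oppr0.
- by move=> M /UP[]; rewrite {1}[M]blk => /Qns_block[_ /nsVP].
rewrite addnC; congr (_ + _)%N.
have NRu : N^R \in unitmx by rewrite map_unitmx.
(* N^-1 intertwines -J'^T with J', so right multiplication by it turns J B J'^T = B into the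
   equation of a homomorphism. *)
have NiJ : invmx N^R *m J' = - (J'^T *m invmx N^R).
  apply: (can_inj (mulKmx NRu)).
  rewrite mulKVmx // mulmxN mulmxA; apply: (can_inj (mulmxK NRu)).
  by rewrite mulNmx -(mulmxA _ (invmx _)) mulVmx // mulmx1; apply/QnsE.
have J'T : J'^T *m J'^T = - 1%:M by rewrite -trmx_mul JJ' linearN /= trmx1.
rewrite (@dim_bij _ _ _
  (mulmxr (invmx N) \o (rsubmx \o usubmx) : {linear 'M_(m + n, m + n) -> 'M_(m, n)})
  _ (homV J J')) //.
- move=> M; rewrite memv_cap => /andP[/UP[]]; rewrite {1}[M]blk.
  move=> /Qns_block[_ _ _ hB] _ _; apply/homVP.
  rewrite /Qhom /= map_mxM map_invmx -mulmxA NiJ mulmxN mulmxA -mulNmx mulmxA.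
  by congr (_ *m _); rewrite -{1}hB mulNmx -!mulmxA J'T !mulmxN mulmx1 opprK.
- move=> M; rewrite memv_cap memv_ker lfunE => /andP[/UP[MN M0] /eqP /= M0'] B0.
  have {}B0 : ursubmx M = 0 by rewrite -[ursubmx M](mulmxKV Nu) B0 mul0mx.
  move: MN; rewrite {1}[M]blk => /Qns_block[_ _ CB _].
  by rewrite [M]blk CB M0 [drsubmx M]M0' B0 trmx0 oppr0 block_mx0.
- move=> Z /homVP ZJ; exists (block_mx 0 (Z *m N) (- (Z *m N)^T) 0); last first.
    by rewrite /= -/(ursubmx _) block_mxKur mulmxK.
  rewrite memv_cap memv_ker lfunE /= -/(drsubmx _) block_mxKdr eqxx andbT.
  apply/UP; rewrite block_mxKul; split => //; apply/Qns_block; split => //.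
  + by apply/nsVP; rewrite mem0v.
  + by apply/nsVP; rewrite mem0v.
  by rewrite map_mxM mulmxA -ZJ -[in RHS]NJ !mulmxA.
Qed.

Lemma dim_hom_dsumr m n p (E : 'M[R]_p) (J : 'M[R]_m) (J' : 'M[R]_n) :
  \dim (homV E (dsum J J')) = (\dim (homV E J) + \dim (homV E J'))%N.
Proof.
have homE (Z : 'M[rat]_(p, m + n)) : Qhom E (dsum J J') Z <->
    Qhom E J (lsubmx Z) /\ Qhom E J' (rsubmx Z).
  rewrite -{1}[Z]hsubmxK /Qhom map_row_mx mul_row_block !mulmx0 addr0 add0r mul_mx_row.
  by split=> [/eq_row_mx//|[-> ->]].
rewrite (@dim_surj _ _ _
  (lsubmx : {linear 'M_(p, m + n) -> 'M_(p, m)}) _ (homV E J)); last first.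
- move=> A hA; exists (row_mx A 0); last exact: row_mxKl.
  by apply/homVP/homE; rewrite row_mxKl row_mxKr -!homVP mem0v.
- by move=> M /homVP/homE[/homVP].
rewrite addnC; congr (_ + _)%N.
apply: (@dim_bij _ _ _ (rsubmx : {linear 'M_(p, m + n) -> 'M_(p, n)})).
- by move=> M; rewrite memv_cap => /andP[/homVP/homE[_ /homVP]].
- move=> M; rewrite memv_cap memv_ker lfunE => /andP[_ /eqP /= l0] r0.
  by rewrite -[M]hsubmxK l0 r0 row_mx0.
- move=> A hA; exists (row_mx 0 A); last exact: row_mxKr.
  rewrite memv_cap memv_ker lfunE /= row_mxKl eqxx andbT.
  by apply/homVP/homE; rewrite row_mxKl row_mxKr -!homVP mem0v.
Qed.

Lemma dim_hom_isog p m n (E : 'M[R]_p) (J : 'M[R]_m) (J' : 'M[R]_n) :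
  Qisog J J' -> \dim (homV E J) = \dim (homV E J').
Proof.
have le m' n' (I : 'M[R]_m') (I' : 'M[R]_n') :
    Qisog I I' -> (\dim (homV E I) <= \dim (homV E I'))%N.
  move=> [Z [ZJ Zf _]].
  apply: (@dim_inj _ _ _ (mulmxr Z : {linear 'M_(p, m') -> 'M_(p, n')})).
    by move=> M /homVP hM; apply/homVP; apply: Qhom_comp hM ZJ.
  by move=> M _ /= MZ; apply: (row_free_inj Zf); rewrite /= mul0mx.
by move=> h; apply/eqP; rewrite eqn_leq !le //; apply: Qisog_sym.
Qed.

Lemma dim_ns_isog m n (J : 'M[R]_m) (J' : 'M[R]_n) :
  Qisog J J' -> \dim (nsV J) = \dim (nsV J').
Proof.
have le m' n' (I : 'M[R]_m') (I' : 'M[R]_n') :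
    Qisog I I' -> (\dim (nsV I') <= \dim (nsV I))%N.
  move=> h; have e := Qisog_size h; case: n' / e I' h => I' [Z [ZJ]].
  rewrite row_free_unit => Zu _.
  apply: (@dim_inj _ _ _ (mulmxr Z^T \o mulmx Z : {linear 'M_(m', m') -> 'M_(m', m')})).
    move=> N /nsVP[NT NJ]; apply/nsVP; split => /=.
      by rewrite !trmx_mul trmxK NT mulNmx mulmxN mulmxA.
    rewrite !map_mxM -map_trmx !mulmxA -ZJ -!(mulmxA (Z^R)); congr (_ *m _).
    rewrite -{2}NJ -!mulmxA; do 2 congr (_ *m _).
    by rewrite -!trmx_mul ZJ.
  move=> N _ /= ZN; apply: (can_inj (mulKmx Zu)); rewrite mulmx0.
  by rewrite -[RHS](mul0mx _ (invmx Z^T)) -ZN mulmxK // unitmx_tr.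
by move=> h; apply/eqP; rewrite eqn_leq !le //; apply: Qisog_sym.
Qed.

End Additivity.

(** * Poincare reducibility *)

Section Poincare.
Variable R : realFieldType.
Local Notation "A ^R" := (map_mx (ratr : rat -> R) A) (at level 2, format "A ^R").
Local Notation ratf := (ratr : {rmorphism rat -> R}).

(** The square of [\det J] is (-1)^m, which is negative for odd m. *)
Lemma cplx_structure_even m (J : 'M[R]_m) : cplx_structure J -> ~~ odd m.
Proof.
move=> JJ; have : \det (J *m J) = (-1) ^+ m.
  by rewrite JJ -scaleN1r detZ det1 mulr1.
rewrite det_mulmx -expr2; apply: contra_eqN => om.
by rewrite -signr_odd om expr1 gt_eqF // (lt_le_trans _ (sqr_ge0 _)) // ltrN10.
Qed.

Lemma cplx_structure_sub k m (J1 : 'M[R]_k) (J : 'M[R]_m) Z :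
  cplx_structure J -> Qhom J1 J Z -> row_free Z -> cplx_structure J1.
Proof.
move=> JJ ZJ; rewrite -(row_free_map ratf) => Zf.
apply: (row_free_inj Zf) => /=.
by rewrite -mulmxA -ZJ mulmxA -ZJ -mulmxA JJ mulmxN mulmx1 mulNmx mul1mx.
Qed.

Lemma Qpolarization_sub k m (J1 : 'M[R]_k) (J : 'M[R]_m) Z N :
  Qpolarization J N -> Qhom J1 J Z -> row_free Z ->
  Qpolarization J1 (Z *m N *m Z^T).
Proof.
move=> [[NT NJ] Npos] ZJ; rewrite -(row_free_map ratf) => Zf; split; first split.
- by rewrite !trmx_mul trmxK NT mulNmx mulmxN mulmxA.
- rewrite !map_mxM -map_trmx !mulmxA -ZJ -!(mulmxA (Z^R)); congr (_ *m _).
  rewrite -[in RHS]NJ -!mulmxA; do 2 congr (_ *m _).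
  by rewrite -!trmx_mul ZJ.
- move=> c c0; have := Npos (c *m Z^R); rewrite !map_mxM -map_trmx trmx_mul !mulmxA.
  rewrite -(mulmxA c Z^R J) ZJ !mulmxA; apply.
  by apply: contra_neq c0 => cZ; apply: (row_free_inj Zf); rewrite /= cZ mul0mx.
Qed.

(** Rational subspaces stable under J stand for abelian subvarieties up to isogeny; J is restricted
    to one in the basis [row_base W]. *)
Lemma stable_sub m (J : 'M[R]_m) k (W : 'M[rat]_(k, m)) :
  (W^R *m J <= W^R)%MS -> exists J1, Qhom J1 J (row_base W).
Proof.
move=> WJ; exists ((row_base W)^R *m J *m pinvmx (row_base W)^R).
have sub : (W^R <= (row_base W)^R)%MS by rewrite map_submx eq_row_base.
rewrite /Qhom mulmxKpV // (submx_trans _ sub) // (submx_trans _ WJ) // submxMr //.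
by rewrite map_submx eq_row_base.
Qed.

(** The complement is the orthogonal W of the row space of Z for the polarization N:
    skew-adjointness makes W stable under J, and positivity makes it meet the row space of Z
    trivially. *)
Lemma poincare k m (J1 : 'M[R]_k) (J : 'M[R]_m) Z :
  cplx_structure J -> polarizable J -> Qhom J1 J Z -> row_free Z ->
  exists q (J2 : 'M[R]_q),
    [/\ cplx_structure J2, polarizable J2 & Qisog (dsum J1 J2) J].
Proof.
move=> JJ [N NP] ZJ Zf; have [[NT NJ'] Npos] := NP; have NJ := (QnsE N JJ).1 NJ'.
have [W WE] : exists W, W = kermx (N *m Z^T) by eexists.
have WN : W^R *m N^R *m (Z^R)^T = 0.
  by rewrite WE map_trmx -mulmxA -!map_mxM mulmx_ker map_mx0.
have WJ : (W^R *m J <= W^R)%MS.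
  rewrite [in X in (_ <= X)%MS]WE map_kermx; apply/sub_kermxP.
  rewrite map_mxM -map_trmx mulmxA -(mulmxA W^R) NJ mulmxN mulNmx mulmxA.
  by rewrite -!mulmxA -trmx_mul ZJ trmx_mul !mulmxA WN mul0mx oppr0.
have [J2 ZJ2] := stable_sub WJ; set Z2 := row_base W in ZJ2.
have Z2f : row_free Z2 by exact: row_base_free.
have Z2N : Z2^R *m N^R *m (Z^R)^T = 0.
  have /submxP[D ->] : (Z2 <= W)%MS by rewrite eq_row_base.
  by rewrite map_mxM -!mulmxA (mulmxA W^R) WN mulmx0.
have colf : row_free (col_mx Z Z2).
  rewrite -(row_free_map ratf) map_col_mx; apply: inj_row_free => v.
  rewrite -[v]hsubmxK mul_row_col; set a := lsubmx v; set b := rsubmx v => ab0.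
  have aE : a *m Z^R = - (b *m Z2^R) by apply/eqP; rewrite -addr_eq0 ab0.
  (* The vector c = aZ = -bZ2 lies in both subspaces. As cJ stays in the row space of Z, N(c, cJ) =
     0, against positivity unless c = 0. *)
  have a0 : a *m Z^R = 0.
    set c := a *m Z^R in aE *; apply: contraTeq isT => /Npos.
    have cJ : c *m J = a *m J1 *m Z^R by rewrite /c -mulmxA ZJ mulmxA.
    have bN : b *m Z2^R *m N^R *m (Z^R)^T = 0.
      by rewrite -2!mulmxA (mulmxA Z2^R) Z2N mulmx0.
    have -> : c *m J *m N^R *m c^T = - (c *m N^R *m (c *m J)^T).
      by rewrite (trmx_mul c) -(mulmxA c) NJ mulmxN mulNmx !mulmxA.
    by rewrite cJ {1}aE (trmx_mul _ Z^R) !mulNmx opprK mulmxA bN mul0mx mxE ltxx.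
  have b0 : b *m Z2^R = 0 by apply/eqP; rewrite -oppr_eq0 -aE a0.
  have -> : a = 0.
    move: Zf; rewrite -(row_free_map ratf) => /row_free_inj inj.
    by apply: inj; rewrite /= a0 mul0mx.
  have -> : b = 0.
    move: Z2f; rewrite -(row_free_map ratf) => /row_free_inj inj.
    by apply: inj; rewrite /= b0 mul0mx.
  exact: row_mx0.
exists (\rank W), J2; split.
- exact: cplx_structure_sub JJ ZJ2 Z2f.
- by exists (Z2 *m N *m Z2^T); apply: Qpolarization_sub NP ZJ2 Z2f.
exists (col_mx Z Z2); split => //.
  by rewrite /Qhom /dsum map_col_mx mul_col_mx mul_block_col !mul0mx addr0 add0r ZJ ZJ2.
(* W is cut out by k linear equations, so its rank is at least m - k. *)
rewrite -col_leq_rank (eqP colf) WE mxrank_ker.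
have : (\rank (N *m Z^T) <= k)%N by apply: rank_leq_col.
by lia.
Qed.

(** Row spaces of square matrices W exhaust the rational subspaces of Q^m. *)
Definition simple m (J : 'M[R]_m) : Prop := (0 < m)%N /\
  forall W : 'M[rat]_m, (W^R *m J <= W^R)%MS -> W = 0 \/ row_full W.

(** A nonzero stable rational subspace of least rank is simple, since its stable subspaces are
    stable in the ambient space. *)
Lemma ex_simple_sub m (J : 'M[R]_m) : (0 < m)%N ->
  exists r (J1 : 'M[R]_r) (Z : 'M[rat]_(r, m)),
    [/\ simple J1, Qhom J1 J Z & row_free Z].
Proof.
move=> m0.
pose good r := `[< exists W : 'M[rat]_m, [/\ (W^R *m J <= W^R)%MS, W != 0 & \rank W = r] >].
have exg : exists r, good r.
  exists m; apply/asboolP; exists 1%:M; rewrite mxrank1 map_mx1 submx1; split => //.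
  by rewrite -mxrank_eq0 mxrank1 -lt0n.
case: (ex_minnP exg) => r /asboolP[W [WJ W0 <-]] rmin.
have [J1 ZJ] := stable_sub WJ; exists (\rank W), J1, (row_base W).
split => //; last exact: row_base_free.
split; first by rewrite lt0n mxrank_eq0.
move=> V VJ; have [->|V0] := eqVneq V 0; [by left|right].
have bf := row_base_free W; have rV : \rank (V *m row_base W) = \rank V by rewrite mxrankMfree.
rewrite -col_leq_rank -rV -(mxrank_gen (_ *m _)); apply: rmin; apply/asboolP.
exists <<V *m row_base W>>%MS; split => //.
  have e : (<<V *m row_base W>>^R :=: (V *m row_base W)^R)%MS.
    exact/map_eqmx/genmxE.
  rewrite e (eqmxMr _ e) map_mxM -mulmxA ZJ mulmxA.
  exact: submxMr.
by rewrite -mxrank_eq0 mxrank_gen rV mxrank_eq0.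
Qed.

(** The kernel of a homomorphism is stable under J, hence zero or everything. *)
Lemma simple_hom_free m n (J : 'M[R]_m) (J' : 'M[R]_n) Z :
  simple J -> Qhom J J' Z -> Z != 0 -> row_free Z.
Proof.
move=> [_ sJ] ZJ Z0; rewrite -kermx_eq0; case: (sJ (kermx Z)) => [|->//|].
  rewrite [X in (_ <= X)%MS]map_kermx; apply/sub_kermxP.
  by rewrite -mulmxA -ZJ mulmxA -map_mxM mulmx_ker map_mx0 mul0mx.
move=> /row_full_inj inj; case/eqP: Z0; apply: inj.
by rewrite mulmx_ker mulmx0.
Qed.

(* Evaluation at a nonzero vector is injective. *)
Lemma dim_hom_simple m n (J : 'M[R]_m) (J' : 'M[R]_n) :
  simple J -> (\dim (homV J J') <= n)%N.
Proof.
move=> sJ; have [m0 _] := sJ; pose v : 'rV[rat]_m := delta_mx 0 (Ordinal m0).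
have v0 : v != 0.
  by apply/eqP => /matrixP/(_ 0 (Ordinal m0)) /eqP; rewrite !mxE !eqxx oner_eq0.
have := @dim_inj _ _ _ (mulmx v : {linear 'M_(m, n) -> 'M_(1, n)}) (homV J J') fullv.
rewrite dimvf dim_matrix mul1r; apply; first by move=> *; apply: memvf.
move=> Z /homVP ZJ /= vZ; apply: contra_neq_eq v0 => /(simple_hom_free sJ ZJ) Zf.
by apply: (row_free_inj Zf); rewrite /= vZ mul0mx.
Qed.

(** The kernel of a class N is stable under J, so a nonzero N is invertible; hence evaluation at v
    is injective on classes. *)
Lemma dim_ns_simple m (J : 'M[R]_m) :
  cplx_structure J -> simple J -> (\dim (nsV J) <= m)%N.
Proof.
move=> JJ sJ; have [m0 sJ'] := sJ; pose v : 'rV[rat]_m := delta_mx 0 (Ordinal m0).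
have v0 : v != 0.
  by apply/eqP => /matrixP/(_ 0 (Ordinal m0)) /eqP; rewrite !mxE !eqxx oner_eq0.
have := @dim_inj _ _ _ (mulmx v : {linear 'M_(m, m) -> 'M_(1, m)}) (nsV J) fullv.
rewrite dimvf dim_matrix mul1r; apply; first by move=> *; apply: memvf.
move=> N /nsVP[_ /(QnsE _ JJ) NJ] /= vN.
case: (sJ' (kermx N)) => [|/eqP|/row_full_inj inj].
- rewrite {2}map_kermx; apply/sub_kermxP.
  by rewrite -mulmxA NJ mulmxN mulmxA -map_mxM mulmx_ker map_mx0 mul0mx oppr0.
- rewrite kermx_eq0 => Nf; case/eqP: v0.
  by apply: (row_free_inj Nf); rewrite /= vN mul0mx.
- by apply: inj; rewrite mulmx_ker mulmx0.
Qed.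

(** An alternating 2 x 2 matrix is determined by its upper right entry, and a polarization is a
    nonzero class. *)
Lemma dim_ns2 (J : 'M[R]_2) :
  cplx_structure J -> polarizable J -> \dim (nsV J) = 1%N.
Proof.
move=> JJ [N NP]; have Nu := polarization_unit JJ NP.
apply/eqP; rewrite eqn_leq; apply/andP; split; last first.
  rewrite lt0n dimv_eq0; apply: contraTneq Nu => ns0.
  have : N \in nsV J by apply/nsVP; case: NP.
  by rewrite ns0 memv0 => /eqP ->; rewrite unitmxE det0 unitr0.
pose f : {linear 'M[rat]_(2, 2) -> 'M[rat]_(1, 1)} :=
  mulmx (delta_mx 0 0 : 'rV_2) \o mulmxr (delta_mx 1 0 : 'cV_2).
have := @dim_inj _ _ _ f (nsV J) fullv.
rewrite dimvf dim_matrix mul1r; apply; first by move=> *; apply: memvf.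
move=> M /nsVP[MT _] /=; rewrite mulmxA -rowE -colE => /matrixP/(_ 0 0).
rewrite !mxE => M01.
have MN i j : M j i = - M i j by move/matrixP: MT => /(_ i j); rewrite !mxE.
have Mii i : M i i = 0 by have := MN i i; lra.
have M10 : M 1 0 = 0 by rewrite MN M01 oppr0.
apply/matrixP => -[[|[|//]] hi] [[|[|//]] hj]; rewrite [RHS]mxE.
- by rewrite -[RHS](Mii 0); congr (M _ _); apply: val_inj.
- by rewrite -[RHS]M01; congr (M _ _); apply: val_inj.
- by rewrite -[RHS]M10; congr (M _ _); apply: val_inj.
- by rewrite -[RHS](Mii 1); congr (M _ _); apply: val_inj.
Qed.

(** A stable subspace inherits a complex structure, so its rank is even. *)
Lemma simple2 (J : 'M[R]_2) : cplx_structure J -> simple J.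
Proof.
move=> JJ; split => // W WJ.
have [J1 ZJ] := stable_sub WJ.
have := cplx_structure_even (cplx_structure_sub JJ ZJ (row_base_free W)).
have : (\rank W <= 2)%N by apply: rank_leq_row.
rewrite /row_full; case E : (\rank W) => [|[|[|//]]] // _ _; last by right.
by left; apply/eqP; rewrite -mxrank_eq0 E.
Qed.

End Poincare.

(** * Bounds on the Picard number *)

(** Here [K] is the multiplicity of a CM curve and [a] the Picard number of the rest. The size of g
    enters only through n^2 < 2(g - n) and 8(n + 1)^2 < g, so the constant 100 is generous. *)
Lemma codim_unique l g n K a : (100 * (l + 1) ^ 2 <= g)%N -> (n <= l)%N ->
  (K <= g < 8 * K)%N -> (a <= (g - K) ^ 2)%N ->
  ((g - n) ^ 2 <= K ^ 2 + a <= (g - n) ^ 2 + n ^ 2)%N -> (g - K = n)%N.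
Proof.
move=> gl nl /andP[Kg gK] aK /andP[ge le].
have gl2 : (100 * (n + 1) ^ 2 <= g)%N.
  by apply: leq_trans gl; rewrite leq_mul2l leq_exp2r ?leq_add2r.
have ns : (n <= (n + 1) ^ 2 /\ n ^ 2 <= (n + 1) ^ 2)%N by clear; nia.
have [m mE] : exists m, g = (K + m)%N by exists (g - K)%N; lia.
have [p pE] : exists p, g = (n + p)%N by exists (g - n)%N; lia.
have mK : (g - K = m)%N by lia.
have pn : (g - n = p)%N by lia.
rewrite mK pn in aK ge le *; clear mK pn gl nl.
(* If m < n, then K >= p + 1 and K^2 exceeds p^2 + n^2, because n^2 < 2p. *)
have [mn|nm|//] := ltngtP m n.
  have : ((p + 1) ^ 2 <= K ^ 2)%N by rewrite leq_exp2r //; lia.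
  have : (n ^ 2 < 2 * p)%N by lia.
  clear -le; nia.
(* If m > n, then (g - n)^2 <= K^2 + m^2 = g^2 - 2Km bounds Km. *)
have Kmn : (K * m <= n * g)%N.
  have : (p ^ 2 <= K ^ 2 + m ^ 2)%N by lia.
  have -> : g = (K + m)%N by [].
  have : (n + p = K + m)%N by rewrite -pE.
  clear; nia.
(* For m >= 8(n + 1) this contradicts g < 8K; otherwise K <= nm, so g = K + m <= (n + 1)m <= 8(n +
   1)^2. *)
have [m1|m1] := leqP (8 * (n + 1)) m.
  have : (K * (8 * (n + 1)) <= K * m)%N by rewrite leq_mul2l m1 orbT.
  have : ((n + 1) * g < (n + 1) * (8 * K))%N by rewrite ltn_pmul2l //; lia.
  clear -Kmn; lia.
have : (K * (n + 1) <= K * m)%N by rewrite leq_mul2l; apply/orP; right; lia.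
have : ((n + 1) * m <= (n + 1) * (8 * (n + 1)))%N by rewrite leq_mul2l ltnW ?orbT.
rewrite {1}mE in Kmn.
clear -Kmn gl2 mE; nia.
Qed.

(** Together the inequalities would give 2(g^2 - 2ng) <= 3g^2/2 + 2g, that is g <= 8n + 4. *)
Lemma small_sqr l g n r : (100 * (l + 1) ^ 2 <= g)%N -> (n <= l)%N ->
  ((g - n) ^ 2 <= r)%N ->
  ~ (2 * r <= g ^ 2 + 2 * g + 2 * (g %/ 4) * g)%N.
Proof.
move=> gl nl ge le.
have gl1 : (100 * (n + 1) <= g)%N by clear -gl nl; nia.
have : ((g - n) ^ 2 + 2 * (n * g) >= g ^ 2)%N.
  have [p ->] : exists p, g = (n + p)%N by exists (g - n)%N; lia.
  by rewrite addKn; clear; nia.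
have : (4 * (g %/ 4) * g <= g * g)%N by rewrite leq_mul2r mulnC leq_trunc_div orbT.
have : (100 * (n + 1) * g <= g * g)%N by rewrite leq_mul2r gl1 orbT.
move: (g %/ 4)%N le => q le; clear -le ge gl1; nia.
Qed.

Section Bounds.
Variable R : realFieldType.

Fixpoint pow_size (m k : nat) : nat := if k is k'.+1 then (m + pow_size m k')%N else 0%N.

Fixpoint dsum_pow m (J : 'M[R]_m) k : 'M[R]_(pow_size m k) :=
  if k is k'.+1 then dsum J (dsum_pow J k') else 0.

Lemma pow_sizeE m k : pow_size m k = (k * m)%N.
Proof. by elim: k => //= k ->; rewrite mulSn. Qed.

Lemma dsum0 m (J0 : 'M[R]_0) (J : 'M[R]_m) : dsum J0 J = J.
Proof. by rewrite /dsum block_mxEh !col_flat_mx row_thin_mx. Qed.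

Lemma dim_hom_eq0 m n (J : 'M[R]_m) (J' : 'M[R]_n) :
  \dim (homV J J') = 0%N <-> forall Z, Qhom J J' Z -> Z = 0.
Proof.
split=> [/eqP|h].
  by rewrite dimv_eq0 => /eqP h Z /homVP; rewrite h memv0 => /eqP.
apply/eqP; rewrite dimv_eq0 -subv0; apply/subvP => Z /homVP/h ->.
exact: mem0v.
Qed.

Lemma Qhom_dsum_pow m n (J : 'M[R]_m) (J' : 'M[R]_n) k :
  (forall Z, Qhom J J' Z -> Z = 0) ->
  forall Z, Qhom (dsum_pow J k) J' Z -> Z = 0.
Proof.
move=> h; elim: k => [Z _|k IH /= Z]; first exact: flatmx0.
rewrite -[Z]vsubmxK /Qhom /dsum map_col_mx mul_col_mx mul_block_col !mul0mx addr0 add0r.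
by move=> /eq_col_mx[/h -> /IH ->]; rewrite col_mx0.
Qed.

Lemma cplx_structure_pow m (J : 'M[R]_m) k :
  cplx_structure J -> cplx_structure (dsum_pow J k).
Proof.
move=> JJ; elim: k => [|k IH] /=; last exact: cplx_structure_dsum.
by rewrite /cplx_structure [LHS]thinmx0 [RHS]thinmx0.
Qed.

Lemma polarizable_dsum m n (J : 'M[R]_m) (J' : 'M[R]_n) :
  polarizable J -> polarizable J' -> polarizable (dsum J J').
Proof.
move=> [N [NJ Npos]] [N' [NJ' Npos']]; exists (block_mx N 0 0 N'); split.
  by apply/Qns_block; split; rewrite ?trmx0 ?oppr0 // map_mx0 mulmx0 mul0mx.
have nn p (I : 'M[R]_p) (M : 'M[rat]_p) :
    (forall c : 'rV[R]_p, c != 0 -> 0 < (c *m I *m map_mx ratr M *m c^T) 0 0) ->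
    forall c : 'rV[R]_p, 0 <= (c *m I *m map_mx ratr M *m c^T) 0 0.
  move=> Mp c; have [->|/Mp/ltW//] := eqVneq c 0.
  by rewrite !mul0mx mxE.
move=> c c0; rewrite -[c]hsubmxK /dsum tr_row_mx map_block_mx !map_mx0.
rewrite !mul_row_block !mulmx0 !addr0 !add0r mul_row_col mxE.
have [l0|l0] := eqVneq (lsubmx c) 0.
  rewrite ltr_wpDl ?nn // Npos' //; apply: contra_neq c0 => r0.
  by rewrite -[c]hsubmxK l0 r0 row_mx0.
by rewrite ltr_pwDl ?nn // Npos.
Qed.

Lemma polarizable_pow m (J : 'M[R]_m) k : polarizable J -> polarizable (dsum_pow J k).
Proof.
move=> Jp; elim: k => [|k IH] /=; last exact: polarizable_dsum.
by exists 0; split => [|c]; rewrite ?[c]thinmx0 ?eqxx //; split; rewrite [LHS]thinmx0 [RHS]thinmx0.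
Qed.

Lemma dim_hom_dsum_pow m n (E : 'M[R]_m) (J : 'M[R]_n) k :
  \dim (homV E (dsum_pow J k)) = (k * \dim (homV E J))%N.
Proof.
elim: k => [|k IH] /=; last by rewrite dim_hom_dsumr IH mulSn.
by apply/dim_hom_eq0 => Z _; apply: thinmx0.
Qed.

(** As long as E maps nontrivially to the rest, simplicity makes the map injective and Poincare
    reducibility splits off one more copy of E. *)
Lemma simple_split p m (E : 'M[R]_p) (X : 'M[R]_m) :
  simple E -> cplx_structure X -> polarizable X ->
  exists K q (A : 'M[R]_q),
    [/\ cplx_structure A, polarizable A, \dim (homV E A) = 0%N
      & Qisog (dsum (dsum_pow E K) A) X].
Proof.
move=> sE; have [p0 _] := sE.
move: {2}m (leqnn m) => b; elim: b m X => [|b IH] m X mb XX Xp.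
  move: mb; rewrite leqn0 => /eqP m0; subst m; exists 0%N, 0%N, X; split => //.
    by apply/dim_hom_eq0 => Z _; apply: thinmx0.
  by rewrite dsum0; apply: Qisog_refl.
have [/dim_hom_eq0 h|h] := pselect (forall Z, Qhom E X Z -> Z = 0).
  by exists 0%N, m, X; split => //; rewrite dsum0; apply: Qisog_refl.
have [Z ZJ Z0] : exists2 Z, Qhom E X Z & Z != 0.
  apply: contra_notP h => h Z ZJ; apply/eqP; apply: contra_notT h => Z0.
  by exists Z.
have [q [Y [YY Yp YX]]] := poincare XX Xp ZJ (simple_hom_free sE ZJ Z0).
have [|K [r [A [AA Ap A0 AY]]]] := IH q Y _ YY Yp.
  by have := Qisog_size YX; lia.
exists K.+1, r, A; split => //=.
apply: Qisog_trans (Qisog_dsumA _ _ _) _.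
exact: Qisog_trans (Qisog_dsum (Qisog_refl _) AY) YX.
Qed.

Lemma dim_hom_split p m q (E : 'M[R]_p) (A : 'M[R]_q) K (X : 'M[R]_m) :
  \dim (homV E A) = 0%N -> Qisog (dsum (dsum_pow E K) A) X ->
  \dim (homV E X) = (K * \dim (homV E E))%N.
Proof.
move=> A0 /(dim_hom_isog E) <-.
by rewrite dim_hom_dsumr A0 addn0 dim_hom_dsum_pow.
Qed.

Lemma dim_hom_simple_self m (E : 'M[R]_m) : simple E -> (0 < \dim (homV E E))%N.
Proof.
move=> [m0 _]; rewrite lt0n; apply/eqP => /dim_hom_eq0/(_ 1%:M).
rewrite /Qhom map_mx1 mul1mx mulmx1 => /(_ erefl) /matrixP/(_ (Ordinal m0) (Ordinal m0)).
by rewrite !mxE eqxx => /eqP; rewrite oner_eq0.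
Qed.

(** The endomorphism rank is at most 2 by evaluation, hence exactly 2, and one more factor adds 1 +
    2k to k^2. *)
Lemma dim_ns_CM_pow (E : 'M[R]_2) k :
  cplx_structure E -> polarizable E -> (1 < \dim (homV E E))%N ->
  \dim (nsV (dsum_pow E k)) = (k ^ 2)%N.
Proof.
move=> EE Ep cm; have e2 : \dim (homV E E) = 2%N.
  by apply/eqP; rewrite eqn_leq cm andbT dim_hom_simple //; apply: simple2.
elim: k => [|k IH] /=.
  apply/eqP; rewrite dimv_eq0 -subv0; apply/subvP => N _.
  by rewrite [N]thinmx0 mem0v.
rewrite dim_ns_dsum ?dim_ns2 ?IH ?dim_hom_dsum_pow ?e2 //; first by lia.
  exact: cplx_structure_pow.
exact: polarizable_pow.
Qed.

Lemma dim_ns_CM_split (E : 'M[R]_2) k n (A : 'M[R]_n) :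
  cplx_structure E -> polarizable E -> (1 < \dim (homV E E))%N ->
  cplx_structure A -> polarizable A -> \dim (homV E A) = 0%N ->
  \dim (nsV (dsum (dsum_pow E k) A)) = (k ^ 2 + \dim (nsV A))%N.
Proof.
move=> EE Ep cm AA Ap /dim_hom_eq0 A0.
have h0 : \dim (homV (dsum_pow E k) A) = 0%N.
  by apply/dim_hom_eq0; apply: Qhom_dsum_pow.
rewrite dim_ns_dsum ?h0 ?addn0 ?dim_ns_CM_pow //; exact: cplx_structure_pow.
Qed.

Lemma simple_decomposition h (X : 'M[R]_(h.*2)) :
  (0 < h)%N -> cplx_structure X -> polarizable X ->
  exists d (B : 'M[R]_(d.*2)) (Y : 'M[R]_((h - d).*2)),
    [/\ (0 < d <= h)%N, simple B, cplx_structure B /\ polarizable B,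
        cplx_structure Y /\ polarizable Y & Qisog (dsum B Y) X].
Proof.
move=> h0 XX [N NP]; have [|r [B [Z [sB ZJ Zf]]]] := @ex_simple_sub _ _ X.
  by rewrite double_gt0.
have BB := cplx_structure_sub XX ZJ Zf.
have Bp : polarizable B by eexists; apply: Qpolarization_sub NP ZJ Zf.
have [q [Y [YY Yp YX]]] := poincare XX (ex_intro _ N NP) ZJ Zf.
have rq := Qisog_size YX.
have [r0 _] := sB.
have re := cplx_structure_even BB.
have [d rE] : exists d, r = d.*2 by exists r./2; rewrite even_halfK.
subst r; have qE : q = (h - d).*2 by move: rq; rewrite -!addnn; lia.
by subst q; exists d, B, Y; split => //; lia.
Qed.

(** With a simple factor of dimension d, induction gives the bound 1 + (h - 1)^2 + 2(h - 1) = h^2 if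
    d = 1, and 2d + (h - d)^2 + 2(h - d) <= h^2 if d >= 2. *)
Lemma dim_ns_le_sqr h (X : 'M[R]_(h.*2)) :
  cplx_structure X -> polarizable X -> (\dim (nsV X) <= h ^ 2)%N.
Proof.
elim/ltn_ind: h X => h IH X XX Xp.
have [h0|h0] := posnP h.
  subst h; suff -> : \dim (nsV X) = 0%N by [].
  apply/eqP; rewrite dimv_eq0 -subv0; apply/subvP => N _.
  by rewrite [N]thinmx0 mem0v.
have [d [B [Y [/andP[d0 dh] sB [BB Bp] [YY Yp] YX]]]] := simple_decomposition h0 XX Xp.
rewrite -(dim_ns_isog YX) dim_ns_dsum //.
have hdh : (h - d < h)%N by lia.
have IHY := IH _ hdh Y YY Yp.
have hBY : (\dim (homV B Y) <= 2 * (h - d))%N by rewrite mul2n dim_hom_simple.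
have nB : (\dim (nsV B) <= 2 * d)%N by rewrite mul2n dim_ns_simple.
have [d1|d1] := eqVneq d 1%N.
  subst d; rewrite (dim_ns2 BB Bp).
  move: (\dim (nsV Y)) (\dim (homV B Y)) IHY hBY => b c; clear -h0; nia.
have d2 : (2 <= d)%N by lia.
move: (\dim (nsV B)) (\dim (nsV Y)) (\dim (homV B Y)) IHY hBY nB => a b c.
clear -d2 dh; have [k ->] : exists k, h = (d + k)%N by exists (h - d)%N; lia.
rewrite addKn; nia.
Qed.

(** For d = 1, Hom(B, Y) has rank at most kappa if B has CM and at most h - 1 otherwise. For d >= 2,
    B adds at most 2d + 2(h - d) = 2h to the rank, which is at most half of the increase of h^2 +
    2h. *)
Lemma dim_ns_le_CM h (X : 'M[R]_(h.*2)) (kappa : nat) :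
  cplx_structure X -> polarizable X ->
  (forall E : 'M[R]_2, cplx_structure E -> polarizable E ->
     (1 < \dim (homV E E))%N -> (\dim (homV E X) <= kappa)%N) ->
  (2 * \dim (nsV X) <= h ^ 2 + 2 * h + 2 * kappa * h)%N.
Proof.
elim/ltn_ind: h X => h IH X XX Xp kX.
have [h0|h0] := posnP h.
  by subst h; have := dim_ns_le_sqr XX Xp; lia.
have [d [B [Y [/andP[d0 dh] sB [BB Bp] [YY Yp] YX]]]] := simple_decomposition h0 XX Xp.
rewrite -(dim_ns_isog YX) dim_ns_dsum //.
have hdh : (h - d < h)%N by lia.
have kBY E : \dim (homV E X) = (\dim (homV E B) + \dim (homV E Y))%N :> nat.
  by rewrite -(dim_hom_isog _ YX) dim_hom_dsumr.
have IHY : (2 * \dim (nsV Y) <= (h - d) ^ 2 + 2 * (h - d) + 2 * kappa * (h - d))%N.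
  apply: IH => // E EE Ep Ecm; apply: leq_trans (kX E EE Ep Ecm).
  by rewrite kBY leq_addl.
have hBY : (\dim (homV B Y) <= 2 * (h - d))%N by rewrite mul2n dim_hom_simple.
have nB : (\dim (nsV B) <= 2 * d)%N by rewrite mul2n dim_ns_simple.
have [d1|d1] := eqVneq d 1%N.
  subst d; rewrite (dim_ns2 BB Bp).
  have [cm|ncm] := ltnP 1 (\dim (homV B B)).
    have := kX B BB Bp cm; rewrite kBY => kY.
    move: (\dim (nsV Y)) (\dim (homV B B)) (\dim (homV B Y)) IHY kY => a b c.
    clear -h0; nia.
  (* Without CM, End(B) has rank 1, so the rank of Hom(B, Y) is the number of copies of B in Y. *)
  have [K [q [A [AA Ap A0 AY]]]] := simple_split sB YY Yp.
  have B1 : \dim (homV B B) = 1%N.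
    by apply/eqP; rewrite eqn_leq ncm dim_hom_simple_self.
  have := dim_hom_split A0 AY; rewrite B1 muln1 => ->.
  have Kh : (K <= h - 1)%N by have := Qisog_size AY; rewrite pow_sizeE; lia.
  move: (\dim (nsV Y)) IHY => b; clear -h0 Kh; nia.
have d2 : (2 <= d)%N by lia.
move: (\dim (nsV B)) (\dim (nsV Y)) (\dim (homV B Y)) IHY hBY nB => a b c.
clear -d2 dh; have [k ->] : exists k, h = (d + k)%N by exists (h - d)%N; lia.
rewrite addKn; nia.
Qed.

Lemma large_ns_CM_split l g n (X : 'M[R]_(g.*2)) :
  (100 * (l + 1) ^ 2 <= g)%N -> (n <= l)%N ->
  cplx_structure X -> polarizable X ->
  ((g - n) ^ 2 <= \dim (nsV X) <= (g - n) ^ 2 + n ^ 2)%N ->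
  exists (E : 'M[R]_2) (A : 'M[R]_(n.*2)),
    [/\ cplx_structure E /\ polarizable E, (1 < \dim (homV E E))%N,
        cplx_structure A /\ polarizable A, \dim (homV E A) = 0%N
      & Qisog X (dsum (dsum_pow E (g - n)) A)].
Proof.
move=> gl nl XX Xp /andP[rho_ge rho_le].
have [[E [EE Ep Ecm Ebig]]|small] := pselect (exists E : 'M[R]_2,
    [/\ cplx_structure E, polarizable E, (1 < \dim (homV E E))%N
      & (g < 4 * \dim (homV E X))%N]).
  have sE := simple2 EE.
  have [K [q [A [AA Ap A0 AX]]]] := simple_split sE XX Xp.
  have qE := Qisog_size AX; rewrite pow_sizeE in qE.
  have Kg : (K <= g)%N by lia.
  have {}qE : q = (g - K).*2 by lia.
  subst q.
  have E2 := dim_hom_simple E sE.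
  have KE := dim_hom_split A0 AX.
  have rhoE : \dim (nsV X) = (K ^ 2 + \dim (nsV A))%N.
    by rewrite -(dim_ns_isog AX) dim_ns_CM_split.
  have rA := dim_ns_le_sqr AA Ap.
  suff gK : (g - K)%N = n.
    have KE' : K = (g - n)%N by lia.
    move: A AA Ap A0 AX {rhoE rA}; rewrite gK => A AA Ap A0 AX; exists E, A; split => //.
    by rewrite -KE'; apply: Qisog_sym.
  rewrite rhoE in rho_ge rho_le.
  (* The rank of Hom(E, X) is K times that of End(E), at most 2K, and it exceeds g / 4. *)
  have gK : (g < 8 * K)%N.
    have : (K * \dim (homV E E) <= K * 2)%N by rewrite leq_mul2l E2 orbT.
    by rewrite -KE; lia.
  by apply: (codim_unique gl nl _ rA); rewrite ?Kg ?gK ?rho_ge.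
exfalso.
have kX (E : 'M[R]_2) : cplx_structure E -> polarizable E -> (1 < \dim (homV E E))%N ->
    (\dim (homV E X) <= g %/ 4)%N.
  move=> EE Ep Ecm; rewrite leq_divRL // mulnC leqNgt; apply/negP => big.
  by apply: small; exists E.
exact: small_sqr gl nl rho_ge (dim_ns_le_CM XX Xp kX).
Qed.

End Bounds.

(** * Complex structures and lattices *)

Section ComplexMatrices.
Variable R : realType.
Local Notation C := R[i].
Local Notation "A ^cx" := (map_mx (real_complex R) A) (at level 2, format "A ^cx").
Local Notation I := ('i%C : C).

Definition Remx m n (M : 'M[C]_(m, n)) : 'M[R]_(m, n) := map_mx (@complex.Re R) M.
Definition Immx m n (M : 'M[C]_(m, n)) : 'M[R]_(m, n) := map_mx (@complex.Im R) M.

Lemma cmx_split m n (M : 'M[C]_(m, n)) : M = (Remx M)^cx + I *: (Immx M)^cx.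
Proof. by apply/matrixP => i j; rewrite !mxE; exact: complexE. Qed.

Lemma Remx_split m n (A B : 'M[R]_(m, n)) : Remx (A^cx + I *: B^cx) = A.
Proof. by apply/matrixP => i j; rewrite !mxE /= !(mul0r, mulr0) subr0 addr0. Qed.

Lemma Immx_split m n (A B : 'M[R]_(m, n)) : Immx (A^cx + I *: B^cx) = B.
Proof. by apply/matrixP => i j; rewrite !mxE /= !(mul0r, mulr0) mul1r !add0r. Qed.

Lemma cmx_eq0 m n (A B : 'M[R]_(m, n)) : A^cx + I *: B^cx = 0 -> A = 0 /\ B = 0.
Proof.
move=> h; split.
  by rewrite -(Remx_split A B) h; apply/matrixP => i j; rewrite !mxE.
by rewrite -(Immx_split A B) h; apply/matrixP => i j; rewrite !mxE.
Qed.

Lemma scaleII m n (M : 'M[C]_(m, n)) : I *: (I *: M) = - M.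
Proof. by rewrite scalerA -expr2 sqr_i scaleN1r. Qed.

Lemma conjC_conjc (z : C) : Num.conj z = conjc z.
Proof. by []. Qed.

Definition conjT m n (M : 'M[C]_(m, n)) : 'M[C]_(n, m) := map_mx Num.conj M^T.

Lemma conjT_mul m n p (A : 'M[C]_(m, n)) (B : 'M[C]_(n, p)) :
  conjT (A *m B) = conjT B *m conjT A.
Proof. by rewrite /conjT trmx_mul map_mxM. Qed.

Lemma conjTK m n (A : 'M[C]_(m, n)) : conjT (conjT A) = A.
Proof. by apply/matrixP => i j; rewrite !mxE conjCK. Qed.

Lemma conjT_split m n (A B : 'M[R]_(m, n)) :
  conjT (A^cx + I *: B^cx) = A^T^cx + I *: (- B^T)^cx.
Proof.
apply/matrixP => i j; rewrite !mxE conjC_conjc /=.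
by apply/eqP; rewrite eq_complex /= !(mul0r, mulr0, mul1r, subr0, addr0, oppr0, add0r) !eqxx.
Qed.

Lemma conjT_real m n (A : 'M[R]_(m, n)) : conjT A^cx = A^T^cx.
Proof.
have := conjT_split A 0; rewrite trmx0 oppr0.
by rewrite !map_mx0 !scaler0 !addr0.
Qed.

Lemma formE g (H : 'M[C]_g) u v : form Num.conj H u v = (u *m H *m conjT v) 0 0.
Proof. by []. Qed.

Lemma hermsymE g (H : 'M[C]_g) : H \is hermsymmx <-> conjT H = H.
Proof.
split; first by move/is_hermitianmxP; rewrite expr0 scale1r.
by move=> h; apply/is_hermitianmxP; rewrite expr0 scale1r [RHS]h.
Qed.

(* [P] has as rows a real basis of C^g, on whose coordinates J is the
   multiplication by i. *)
Definition real_basis m g (P : 'M[C]_(m, g)) (J : 'M[R]_m) : Prop :=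
  bijective (fun c : 'rV[R]_m => c^cx *m P) /\ I *: P = J^cx *m P.

Section RealBasis.
Variables (m g : nat) (P : 'M[C]_(m, g)) (J : 'M[R]_m).
Hypothesis PJ : real_basis P J.

Lemma real_basis_inj k (A B : 'M[R]_(k, m)) : A^cx *m P = B^cx *m P -> A = B.
Proof.
move=> e; have [/bij_inj inj _] := PJ; apply/row_matrixP => i; apply: inj.
by rewrite /= !map_row -!row_mul e.
Qed.

Lemma real_basis_cplx : cplx_structure J.
Proof.
have [_ e] := PJ; apply: real_basis_inj.
by rewrite map_mxM -mulmxA -e -scalemxAr -e scaleII map_mxN map_mx1 mulNmx mul1mx.
Qed.

(** The rows of S are the real coordinates of the standard basis of C^g in the basis P. *)
Lemma real_basis_section : exists S : 'M[R]_(g, m), S^cx *m P = 1%:M.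
Proof.
have [[f _ fK] _] := PJ; exists (\matrix_i f (row i 1%:M)).
by apply/row_matrixP => i; rewrite row_mul -map_row rowK fK.
Qed.

Variable S : 'M[R]_(g, m).
Hypothesis SP : S^cx *m P = 1%:M.

(** Each row of P is expanded along the standard basis with coefficients Re + i Im; in real
    coordinates i becomes J. *)
Lemma real_basis_one : Remx P *m S + Immx P *m S *m J = 1%:M.
Proof.
have [_ PI] := PJ; apply: real_basis_inj; rewrite map_mx1 mul1mx [RHS]cmx_split.
rewrite map_mxD !map_mxM mulmxDl -!mulmxA SP mulmx1 -PI; congr (_ + _).
by rewrite -!scalemxAr SP mulmx1.
Qed.

(* The real section S becomes inverse to P on the i-eigenspace of J. *)
Lemma real_basis_eigen k (M : 'M[C]_(m, k)) :
  J^cx *m M = I *: M -> P *m S^cx *m M = M.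
Proof.
move=> JM; rewrite -[RHS]mul1mx -[in RHS](map_mx1 (real_complex R)) -real_basis_one.
rewrite map_mxD !map_mxM mulmxDl -[X in _ = _ + X]mulmxA JM [in LHS](cmx_split P).
by rewrite !mulmxDl -!scalemxAl -!scalemxAr.
Qed.

(** The real matrices [row_mx (Remx P) (Immx P)] and [col_mx S (S *m J)] are inverse to each
    other. *)
Lemma real_basis_size : m = g.*2.
Proof.
have [_ PI] := PJ.
have [SA SB] : S *m Remx P = 1%:M /\ S *m Immx P = 0.
  have : (S *m Remx P - 1%:M)^cx + I *: (S *m Immx P)^cx = 0.
    rewrite map_mxB !map_mxM map_mx1 -SP [X in _ - _ *m X]cmx_split mulmxDr.
    by rewrite -scalemxAr addrAC subrr.
  by move=> /cmx_eq0[/eqP]; rewrite subr_eq0 => /eqP.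
have [SJA SJB] : S *m J *m Remx P = 0 /\ S *m J *m Immx P = 1%:M.
  have : (S *m J *m Remx P)^cx + I *: (S *m J *m Immx P - 1%:M)^cx = 0.
    have IE : I *: 1%:M = S^cx *m J^cx *m P by rewrite -mulmxA -PI -scalemxAr SP.
    rewrite map_mxB scalerBr !map_mxM map_mx1 IE [X in _ - _ *m X]cmx_split.
    by rewrite mulmxDr -scalemxAr addrA subrr.
  by move=> /cmx_eq0[-> /eqP]; rewrite subr_eq0 => /eqP.
rewrite -addnn; apply/eqP; rewrite eqn_leq; apply/andP; split.
  apply: (@mulmx1_min R _ _ (row_mx (Remx P) (Immx P)) (col_mx S (S *m J))).
  by rewrite mul_row_col mulmxA real_basis_one.
apply: (@mulmx1_min R _ _ (col_mx S (S *m J)) (row_mx (Remx P) (Immx P))).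
by rewrite mul_col_row SA SB SJA SJB -scalar_mx_block.
Qed.

End RealBasis.

Lemma ex_cplx_of_real_basis m g (P : 'M[C]_(m, g)) :
  bijective (fun c : 'rV[R]_m => c^cx *m P) -> exists J, real_basis P J.
Proof.
move=> bP; have [f _ fK] := bP; exists (\matrix_i f (row i (I *: P))); split => //.
by apply/row_matrixP => i; rewrite row_mul -map_row rowK fK.
Qed.

(** T = J + i satisfies JT = iT, and the columns of P form a basis of its column space. For real c,
    cP = 0 implies cT = 0, whose imaginary part is c. *)
Lemma ex_real_basis m (J : 'M[R]_m) : cplx_structure J ->
  exists g (P : 'M[C]_(m, g)), real_basis P J.
Proof.
move=> JJ; pose T := J^cx + I *: 1%:M.
have JJc : J^cx *m J^cx = - 1%:M by rewrite -map_mxM JJ map_mxN map_mx1.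
have JT : I *: T = J^cx *m T.
  by rewrite /T scalerDr mulmxDr scaleII JJc -scalemxAr mulmx1 addrC.
have [P [PT Pf]] : exists P : 'M[C]_(m, \rank T),
    P *m row_base T = T /\ pinvmx P *m P = 1%:M.
  by exists (col_base T); rewrite mulmx_base mulVpmx ?col_base_full.
exists (\rank T), P.
have PI : I *: P = J^cx *m P.
  apply: (row_free_inj (row_base_free T)) => /=.
  by rewrite -scalemxAl -mulmxA PT.
(* If w = (x + iy)P with x, y real, then w = (x + yJ)P, since iP = JP. *)
split => //; exists (fun w => Remx (w *m pinvmx P) + Immx (w *m pinvmx P) *m J).
  move=> c /=; apply/eqP; rewrite -subr_eq0; apply/eqP.
  set a := Remx _; set b := Immx _.
  have : (a + b *m J - c)^cx *m P = 0.
    rewrite map_mxB map_mxD map_mxM mulmxBl mulmxDl -mulmxA -PI -scalemxAr scalemxAl -mulmxDl.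
    rewrite -cmx_split -mulmxA Pf mulmx1; exact: subrr.
  move/(congr1 (mulmx^~ (row_base T))); rewrite -mulmxA PT mul0mx.
  by rewrite mulmxDr -scalemxAr mulmx1 -map_mxM => /cmx_eq0[].
move=> w; rewrite map_mxD map_mxM mulmxDl -mulmxA -PI -scalemxAr scalemxAl -mulmxDl.
by rewrite -cmx_split -mulmxA Pf mulmx1.
Qed.

End ComplexMatrices.

(** * Common denominators and ranks over Z *)

Lemma common_denominator (T : finType) (q : T -> rat) :
  exists D (c : T -> int), (0 < D)%N /\ forall i, q i *+ D = (c i)%:~R.
Proof.
exists (absz (\prod_i denq (q i))), (fun i => numq (q i) * \prod_(j | j != i) denq (q j)).
have pos (P : pred T) : 0 < \prod_(i | P i) denq (q i) by apply: prodr_gt0 => i _; apply: denq_gt0.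
split; first by rewrite absz_gt0 gt_eqF.
move=> i; rewrite pmulrn gez0_abs ?ltW //.
by rewrite (bigD1 i) //= -[LHS]mulrzr !intrM mulrA numqE.
Qed.

Lemma clear_denominators m n (Z : 'M[rat]_(m, n)) :
  exists D (Y : 'M[int]_(m, n)), (0 < D)%N /\ Z *+ D = map_mx intr Y.
Proof.
have [D [c [D0 cE]]] := common_denominator (fun k : 'I_m * 'I_n => Z k.1 k.2).
exists D, (\matrix_(i, j) c (i, j)); split => //.
by apply/matrixP => i j; rewrite !mxE -(cE (i, j)) mulmxnE.
Qed.

Lemma is_Zrank_unique (V : zmodType) (S : set V) r r' :
  is_Zrank S r -> is_Zrank S r' -> r = r'.
Proof.
move=> h h'; apply/eqP; rewrite eqn_leq.
by apply/andP; split; [apply/h'/h|apply/h/h'].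
Qed.

(** [S] lies in the copy G(U) of a rational space and contains a positive multiple of each of its
    elements, so integral independence in [S] amounts to rational independence in U. *)
Lemma Zrank_dim (W : vectType rat) (V : zmodType) (G : {additive W -> V})
    (U : {vspace W}) (S : set V) :
  {in U, forall u, G u = 0 -> u = 0} ->
  (forall s, S s -> exists2 u, u \in U & G u = s) ->
  (forall u, u \in U -> exists D, (0 < D)%N /\ S (G (u *+ D))) ->
  Zrank S = \dim U.
Proof.
move=> Ginj GS SG; have rk : is_Zrank S (\dim U).
  move=> k; split.
    move=> [v [vS vfree]].
    have /choice[u uP] i : exists u, u \in U /\ G u = v i.
      by have [x xU Gx] := GS _ (vS i); exists x.
    have ufree : free [tuple u i | i < k].
      apply/freeP => q; under eq_bigr => i _ do rewrite (nth_map i) ?size_enum_ord // nth_ord_enum.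
      move=> q0 i; have [D [c [D0 cE]]] := common_denominator q.
      have : \sum_i v i *~ c i = 0.
        have <- : G ((\sum_i q i *: u i) *+ D) = \sum_i v i *~ c i.
          rewrite -sumrMnl raddf_sum; apply: eq_bigr => j _.
          by rewrite scalerMnl cE scaler_int raddfMz (uP j).2.
        by rewrite q0 mul0rn raddf0.
      move=> /vfree/(_ i) ci0; have := cE i; rewrite ci0 => /eqP.
      by rewrite mulrn_eq0 eqn0Ngt D0 => /eqP.
    rewrite -(size_tuple [tuple u i | i < k]) -(eqP ufree) dimvS //.
    by apply/span_subvP => _ /mapP[i _ ->]; case: (uP i).
  (* Conversely, the first k vectors of a basis of U, each scaled into [S], are free over Z. *)
  move=> kU; pose X := vbasis U.
  have XU (i : 'I_k) : X`_i \in U.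
    apply: vbasis_mem; apply: mem_nth.
    by rewrite size_tuple (leq_trans (ltn_ord i)).
  have [D DP] := choice (fun i => SG _ (XU i)).
  exists (fun i : 'I_k => G (X`_i *+ D i)); split; first by move=> i; case: (DP i).
  move=> c; under eq_bigr => i _ do rewrite -raddfMz.
  have mem : \sum_(i < k) X`_i *+ D i *~ c i \in U.
    by apply: rpred_sum => i _; rewrite rpredMz ?rpredMn.
  rewrite -raddf_sum => G0; have {G0 mem} c0 := Ginj _ mem G0.
  move=> i; have tf : free (take k X).
    apply: (@catl_free _ _ (drop k X)); rewrite cat_take_drop.
    exact: basis_free (vbasisP U).
  have ts : size (take k X) == k by rewrite size_takel // size_tuple.
  have /freeP ff : free (Tuple ts) by [].
  have e : \sum_(j < k) (((D j)%:Z * c j)%:~R : rat) *: (take k X)`_j =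
      \sum_(j < k) X`_j *+ D j *~ c j.
    apply: eq_bigr => j _; rewrite nth_take // scaler_int mulrzA.
    by rewrite pmulrn.
  have /eqP := ff (fun i => ((D i)%:Z * c i)%:~R) (etrans e c0) i.
  rewrite intr_eq0 mulf_eq0 => /orP[|/eqP //].
  by have [D0 _] := DP i; rewrite eqz_nat eqn0Ngt D0.
(* A rank exists, so the default value of [xget] is excluded. *)
rewrite /Zrank; case: xgetP => [r _ /is_Zrank_unique/(_ rk)//|/(_ _ rk)//].
Qed.

(** * The Neron-Severi group *)

Section NeronSeveri.
Variable R : realType.
Local Notation C := R[i].
Local Notation "A ^R" := (map_mx (ratr : rat -> R) A) (at level 2, format "A ^R").
Local Notation "A ^cx" := (map_mx (real_complex R) A) (at level 2, format "A ^cx").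
Local Notation I := ('i%C : C).

Lemma ratr_intmx m n (Z : 'M[int]_(m, n)) : (map_mx intr Z)^R = map_mx intr Z.
Proof. by apply/matrixP => i j; rewrite !mxE ratr_int. Qed.

Lemma intmx_cx m n (Z : 'M[int]_(m, n)) : (map_mx intr Z)^cx = map_mx intr Z :> 'M[C]_(m, n).
Proof. by apply/matrixP => i j; rewrite !mxE rmorph_int. Qed.

Definition represents g (A : abvar R g) m (J : 'M[R]_m) (P : 'M[C]_(m, g)) : Prop :=
  real_basis P J /\ lattice A = [set map_mx intr z *m P | z in [set: 'rV[int]_m]].

Section Hermitian.
Variables (m g : nat) (J : 'M[R]_m) (P : 'M[C]_(m, g)) (S : 'M[R]_(g, m)).
Hypotheses (PJ : real_basis P J) (SP : S^cx *m P = 1%:M).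

Let JJ := real_basis_cplx PJ.

(* The Hermitian form with imaginary part N in the basis P: its real part
   is H(x, y) = N(ix, y). *)
Definition hermitian_of (N : 'M[rat]_m) : 'M[C]_g :=
  S^cx *m ((J *m N^R)^cx + I *: N^R^cx) *m S^T^cx.

Fact hermitian_of_zmod_morphism : zmod_morphism hermitian_of.
Proof.
move=> N N'; rewrite /hermitian_of map_mxB [J *m _]mulmxBr !map_mxB scalerBr addrACA -opprD.
by rewrite mulmxBr mulmxBl.
Qed.

HB.instance Definition _ := GRing.isZmodMorphism.Build
  'M[rat]_m 'M[C]_g hermitian_of hermitian_of_zmod_morphism.

(** M = JN + iN is Hermitian with JM = iM, so [real_basis_eigen] absorbs P S on the left and, after
    conjugate transposition, its adjoint on the right. *)
Lemma hermitian_pullback N : Qns J N ->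
  P *m hermitian_of N *m conjT P = (J *m N^R)^cx + I *: N^R^cx.
Proof.
move=> [NT /(QnsE _ JJ) NJ]; set M := _ + _.
have JM : J^cx *m M = I *: M.
  rewrite /M mulmxDr -map_mxM mulmxA JJ mulNmx mul1mx map_mxN.
  by rewrite scalerDr scaleII addrC -scalemxAr -map_mxM.
have Mh : conjT M = M.
  rewrite conjT_split trmx_mul map_trmx NT map_mxN.
  by rewrite opprK mulNmx -NJ.
have PSM := real_basis_eigen PJ SP JM.
rewrite /hermitian_of !mulmxA PSM -conjT_real -mulmxA -conjT_mul -{1}Mh -conjT_mul.
by rewrite PSM Mh.
Qed.

Lemma hermitian_ofP N : Qns J N -> hermitian_of N \is hermsymmx.
Proof.
move=> [NT /(QnsE _ JJ) NJ]; apply/hermsymE.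
rewrite /hermitian_of -conjT_real !conjT_mul conjTK mulmxA; do 2 congr (_ *m _).
rewrite conjT_split trmx_mul map_trmx NT map_mxN.
by rewrite opprK mulNmx -NJ.
Qed.

Lemma form_pullback (H : 'M[C]_g) (c d : 'rV[R]_m) :
  form Num.conj H (c^cx *m P) (d^cx *m P) = (c^cx *m (P *m H *m conjT P) *m d^T^cx) 0 0.
Proof. by rewrite formE conjT_mul conjT_real !mulmxA. Qed.

Lemma form_hermitian_of N (c d : 'rV[R]_m) : Qns J N ->
  form Num.conj (hermitian_of N) (c^cx *m P) (d^cx *m P) =
  Complex ((c *m J *m N^R *m d^T) 0 0) ((c *m N^R *m d^T) 0 0).
Proof.
move=> NN; rewrite form_pullback hermitian_pullback // mulmxDr mulmxDl.
rewrite -scalemxAr -scalemxAl -!map_mxM !mulmxA !mxE.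
by apply/eqP; rewrite eq_complex /= !(mul0r, mulr0, mul1r, subr0, addr0, oppr0, add0r) !eqxx.
Qed.

(** The matrix M of H in the basis P satisfies JM = iM, whose imaginary part reads Re M = J Im M, so
    Im M determines H; M being Hermitian makes Im M alternating. *)
Lemma hermitian_recover (H : 'M[C]_g) N :
  H \is hermsymmx -> N^R = Immx (P *m H *m conjT P) ->
  Qns J N /\ hermitian_of N = H.
Proof.
move=> /hermsymE Hh NE; set M := P *m H *m conjT P in NE.
have [_ PI] := PJ.
have Mh : conjT M = M by rewrite /M !conjT_mul conjTK Hh mulmxA.
have JM : J^cx *m M = I *: M by rewrite /M !mulmxA -PI -!scalemxAl.
have MR : Remx M = J *m N^R.
  rewrite NE; move: JM; rewrite {1 2}[M]cmx_split mulmxDr scalerDr scaleII -scalemxAr -!map_mxM.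
  move=> /(congr1 (@Immx R _ _)); rewrite Immx_split addrC -map_mxN Immx_split.
  by move=> ->.
have ME : M = (J *m N^R)^cx + I *: N^R^cx by rewrite [LHS]cmx_split MR -NE.
have inj : injective (map_mx (ratr : rat -> R) : 'M_(m, m) -> 'M_(m, m)).
  exact: (map_mx_inj (f := (ratr : {rmorphism rat -> R}))).
have NT : N^T = - N.
  apply: inj; rewrite map_mxN -map_trmx; move: Mh.
  rewrite ME conjT_split => /(congr1 (@Immx R _ _)).
  by rewrite !Immx_split => e; rewrite -[in RHS]e opprK.
split; first split => //.
  apply/(QnsE _ JJ); move: Mh; rewrite ME conjT_split.
  move=> /(congr1 (@Remx R _ _)); rewrite !Remx_split => <-.
  by rewrite trmx_mul map_trmx NT map_mxN mulNmx.
by rewrite /hermitian_of -ME /M !mulmxA SP mul1mx -conjT_real -mulmxA -conjT_mul SP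
  /conjT trmx1 map_mx1 mulmx1.
Qed.

End Hermitian.

Section Represented.
Variables (m g : nat) (A : abvar R g) (J : 'M[R]_m) (P : 'M[C]_(m, g)).
Hypothesis AJ : represents A J P.

Lemma latticeP u : lattice A u <-> exists z, u = (map_mx intr z : 'rV_m)^cx *m P.
Proof.
rewrite AJ.2; split=> [[z _ <-]|[z ->]]; exists z; by rewrite ?intmx_cx.
Qed.

Lemma neron_severi_recover S H : S^cx *m P = 1%:M -> neron_severi (lattice A) H ->
  exists N, Qns J N /\ hermitian_of J S N = H.
Proof.
move=> SP [Hh Hint].
have [Y YE] : exists Y : 'M[int]_m, map_mx intr Y = Immx (P *m H *m conjT P).
  have Yij (ij : 'I_m * 'I_m) : exists y : int, (Immx (P *m H *m conjT P)) ij.1 ij.2 = y%:~R.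
    apply/intrP; pose e i : 'rV[int]_m := delta_mx 0 i.
    have eR i : map_mx intr (e i) = delta_mx 0 i :> 'rV[R]_m.
      by apply/matrixP => a b; rewrite !mxE; case: (_ && _).
    have := Hint _ _ ((latticeP _).2 (ex_intro _ (e ij.1) erefl))
                     ((latticeP _).2 (ex_intro _ (e ij.2) erefl)).
    rewrite form_pullback !eR trmx_delta !map_delta_mx -rowE -colE.
    by rewrite !mxE.
  have [f fE] := choice Yij; exists (\matrix_(i, j) f (i, j)).
  by apply/matrixP => i j; rewrite mxE [in LHS]mxE -fE.
exists (map_mx intr Y); apply: (hermitian_recover AJ.1 SP Hh).
by rewrite ratr_intmx.
Qed.

(** [hermitian_of] embeds the rational classes into the Hermitian forms. Its image contains NS, and
    clearing the denominators of N brings a multiple of each class into NS. *)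
Lemma picard_numberE : picard_number A = \dim (nsV J).
Proof.
have [S SP] := real_basis_section AJ.1.
apply: (@Zrank_dim _ _ (hermitian_of J S : {additive 'M[rat]_(m, m) -> 'M[C]_g})).
- move=> N /nsVP NN /= H0; have := hermitian_pullback AJ.1 SP NN.
  rewrite H0 mulmx0 mul0mx => /esym/cmx_eq0[_ N0].
  by apply: (map_mx_inj (f := (ratr : {rmorphism rat -> R}))); rewrite N0 map_mx0.
- by move=> H /(neron_severi_recover SP)[N [/nsVP NN HE]]; exists N.
- move=> N NN; have [D [Y [D0 YE]]] := clear_denominators N; exists D; split => //=.
  have /nsVP NDN : N *+ D \in nsV J by apply: rpredMn.
  split; first by refine (hermitian_ofP S AJ.1 NDN).
  move=> _ _ /latticeP[z ->] /latticeP[t ->].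
  rewrite (form_hermitian_of AJ.1 SP _ _ NDN) /= YE ratr_intmx.
  by rewrite map_trmx -!map_mxM mxE intr_int.
Qed.

Lemma represents_polarizable : polarizable J.
Proof.
have [S SP] := real_basis_section AJ.1.
have [H [HN Hpos]] := lattice_polarizable A.
have [N [NN HE]] := neron_severi_recover SP HN; exists N; split => // c c0.
have := Hpos (c^cx *m P); rewrite -HE (form_hermitian_of AJ.1 SP _ _ NN).
rewrite ltcE /= => /(_ _)/andP[] //.
apply: contra_neq c0 => c0; apply: (real_basis_inj AJ.1).
by rewrite c0 map_mx0 mul0mx.
Qed.

End Represented.

Lemma ex_represents g (A : abvar R g) :
  exists m (J : 'M[R]_m) (P : 'M[C]_(m, g)), represents A J P.
Proof.
have [m [P [bP LE]]] := lattice_is_lattice A.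
by have [J PJ] := ex_cplx_of_real_basis bP; exists m, J, P.
Qed.

Lemma represents_size g (A : abvar R g) m (J : 'M[R]_m) (P : 'M[C]_(m, g)) :
  represents A J P -> m = g.*2.
Proof.
move=> [PJ _]; have [S SP] := real_basis_section PJ.
by refine (real_basis_size PJ SP).
Qed.

(** The lattice is the Z-span of a real basis adapted to J, polarized by an integral multiple of
    N. *)
Lemma ex_abvar g (J : 'M[R]_(g.*2)) : cplx_structure J -> polarizable J ->
  exists (A : abvar R g) (P : 'M[C]_(g.*2, g)), represents A J P.
Proof.
move=> JJ [N [NN Npos]]; have [h [P PJ]] := ex_real_basis JJ.
have [S SP] := real_basis_section PJ.
have hg : h = g by have := real_basis_size PJ SP; lia.
subst h; pose L := [set map_mx intr z *m P | z in [set: 'rV[int]_(g.*2)]].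
have Llat : is_lattice L by exists g.*2, P; split => //; exact: PJ.1.
have [D [Y [D0 YE]]] := clear_denominators N.
have NDN : Qns J (N *+ D) by apply/nsVP/rpredMn/nsVP.
have Lpol : exists H, polarization L H.
  exists (hermitian_of J S (N *+ D)); split; first split.
  - by refine (hermitian_ofP S PJ NDN).
  - move=> _ _ [z _ <-] [t _ <-]; rewrite -!intmx_cx.
    rewrite (form_hermitian_of PJ SP _ _ NDN) /= YE ratr_intmx.
    by rewrite map_trmx -!map_mxM mxE intr_int.
  move=> u u0; have [f _ fK] := PJ.1; rewrite -[u]fK.
  set c := f u; have c0 : c != 0.
    by apply: contra_neq u0 => c0; rewrite -[u]fK -/c c0 map_mx0 mul0mx.
  (* Positivity in [R[i]] includes a zero imaginary part, which holds because N is alternating. *)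
  rewrite (form_hermitian_of PJ SP _ _ NDN) ltcE /=; apply/andP; split.
    have /matrixP/(_ 0 0) : (c *m (N *+ D)^R *m c^T)^T = - (c *m (N *+ D)^R *m c^T).
      by rewrite !trmx_mul trmxK map_trmx NDN.1 map_mxN mulNmx mulmxN mulmxA.
    by rewrite [LHS]mxE [RHS]mxE => ?; apply/eqP; lra.
  rewrite -scaler_nat map_mxZ -scalemxAr -scalemxAl mxE mulr_gt0 ?Npos //.
  by rewrite rmorph_nat ltr0n.
by exists (AbVar Llat Lpol), P.
Qed.

End NeronSeveri.

(** * Homomorphisms and isogenies *)

Lemma eq_of_diff_multiple (N a b : nat) (q : int) :
  (a < N)%N -> (b < N)%N -> a%:Z - b%:Z = N%:Z * q -> a = b.
Proof.
move=> aN bN e; have [q1|[q0|q1]] : q <= -1 \/ q = 0 \/ 1 <= q by lia.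
- have : N%:Z * q <= - N%:Z by nia.
  by lia.
- by move: e; rewrite q0 mulr0; lia.
- have : N%:Z <= N%:Z * q by nia.
  by lia.
Qed.

Section Homomorphisms.
Variable R : realType.
Local Notation C := R[i].
Local Notation "A ^R" := (map_mx (ratr : rat -> R) A) (at level 2, format "A ^R").
Local Notation "A ^cx" := (map_mx (real_complex R) A) (at level 2, format "A ^cx").
Local Notation "Z ^Z" := (map_mx (intr : int -> R) Z) (at level 2, format "Z ^Z").
Local Notation I := ('i%C : C).

Section Pair.
Variables (g h : nat) (A : abvar R g) (B : abvar R h) (m n : nat).
Variables (J : 'M[R]_m) (P : 'M[C]_(m, g)) (J' : 'M[R]_n) (P' : 'M[C]_(n, h)).
Hypotheses (AJ : represents A J P) (BJ : represents B J' P').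

Lemma hom_lift F : abvar_hom A B F ->
  exists Z : 'M[int]_(m, n), P *m F = Z^Z^cx *m P' /\ Qhom J J' (map_mx intr Z).
Proof.
move=> hF.
have rowP i : exists z : 'rV[int]_n, row i P *m F = z^Z^cx *m P'.
  apply/(latticeP BJ)/hF/(latticeP AJ); exists (delta_mx 0 i).
  by rewrite map_delta_mx map_delta_mx -rowE.
have [z zE] := choice rowP.
have PF : P *m F = (\matrix_i z i)^Z^cx *m P'.
  by apply/row_matrixP => i; rewrite !row_mul zE -!map_row rowK.
exists (\matrix_i z i); split => //.
rewrite /Qhom ratr_intmx; apply: (real_basis_inj BJ.1).
rewrite !map_mxM -!mulmxA -PF -BJ.1.2 -scalemxAr -PF mulmxA -AJ.1.2.
by rewrite scalemxAl.
Qed.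

Lemma lift_hom (Z : 'M[int]_(m, n)) F :
  P *m F = Z^Z^cx *m P' -> abvar_hom A B F.
Proof.
move=> PF _ /(latticeP AJ)[z ->]; apply/(latticeP BJ); exists (z *m Z).
by rewrite -mulmxA PF mulmxA -!map_mxM.
Qed.

(** The map is F = S Z P'. Since J Z P' = Z J' P' = i Z P', [real_basis_eigen] gives P F = Z P'. *)
Lemma Qhom_hom (Z : 'M[int]_(m, n)) : Qhom J J' (map_mx intr Z) ->
  exists2 F, abvar_hom A B F & P *m F = Z^Z^cx *m P'.
Proof.
rewrite /Qhom ratr_intmx => ZJ; have [S SP] := real_basis_section AJ.1.
have PF : P *m (S^cx *m (Z^Z^cx *m P')) = Z^Z^cx *m P'.
  rewrite !mulmxA -(mulmxA (P *m _)); apply: (real_basis_eigen AJ.1 SP).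
  by rewrite mulmxA -map_mxM -ZJ map_mxM -mulmxA -BJ.1.2 scalemxAr.
by exists (S^cx *m (Z^Z^cx *m P')) => //; apply: lift_hom PF.
Qed.

Lemma lift_eq0 (Z : 'M[int]_(m, n)) F : P *m F = Z^Z^cx *m P' -> F = 0 <-> Z = 0.
Proof.
move=> PF; split=> [F0|Z0].
  have : Z^Z = 0.
    by apply: (real_basis_inj BJ.1); rewrite -PF F0 mulmx0 map_mx0 mul0mx.
  move=> /matrixP e; apply/matrixP => i j; have := e i j; rewrite !mxE.
  by move/eqP; rewrite intr_eq0 => /eqP.
have [S SP] := real_basis_section AJ.1.
by rewrite -[F]mul1mx -SP -mulmxA PF Z0 !map_mx0 mul0mx mulmx0.
Qed.

Lemma abvar_hom_eq0 : abvar_hom A B = [set 0] <-> \dim (homV J J') = 0%N.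
Proof.
split=> [hom0|/dim_hom_eq0 hom0].
  apply/dim_hom_eq0 => Z /homVP hZ; have [D [Y [D0 YE]]] := clear_denominators Z.
  have /homVP hY : Z *+ D \in homV J J' by apply: rpredMn.
  move: hY; rewrite YE => /Qhom_hom[F hF PF].
  have F0 : F = 0 by have : [set 0] F by rewrite -hom0.
  have Y0 := (lift_eq0 PF).1 F0.
  move: YE; rewrite Y0 map_mx0 => /eqP.
  by rewrite -scaler_nat scaler_eq0 pnatr_eq0 eqn0Ngt D0 => /eqP.
apply/seteqP; split => [F /hom_lift[Z [PF /hom0 Z0]]|_ ->] /=.
  apply/(lift_eq0 PF)/matrixP => i j; move/matrixP/(_ i j): Z0; rewrite !mxE.
  by move/eqP; rewrite intr_eq0 => /eqP.
by apply: (@lift_hom 0); rewrite !map_mx0 mulmx0 mul0mx.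
Qed.

End Pair.

(** Multiplications by integers correspond to the integral points of the line of [1%:M], so CM means
    that the rational endomorphisms exceed this line. *)
Lemma has_CM_dim (E : abvar R 1) m (J : 'M[R]_m) P : represents E J P ->
  has_CM E <-> (1 < \dim (homV J J))%N.
Proof.
move=> EJ; have m2 := represents_size EJ.
have [S SP] := real_basis_section EJ.1.
have one_in : 1%:M \in homV J J.
  by apply/homVP; rewrite /Qhom map_mx1 mul1mx mulmx1.
have one0 : (1%:M : 'M[rat]_m) != 0 by rewrite -mxrank_eq0 mxrank1 m2.
have line_sub : (<[1%:M]> <= homV J J)%VS by rewrite -memvE.
have line1 : \dim <[1%:M : 'M[rat]_m]> = 1%N by rewrite dim_vline one0.
have PS (k : int) : P *m k%:~R%:M = (k%:M : 'M[int]_m)^Z^cx *m P.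
  by rewrite mul_mx_scalar !map_scalar_mx mul_scalar_mx /= rmorph_int.
split.
  move=> [F hF Fk]; have [Z [PF /homVP hZ]] := hom_lift EJ EJ hF.
  rewrite ltnNge; apply/negP => le1.
  have e : <[1%:M]>%VS = homV J J.
    by apply/eqP; rewrite -(dimv_leqif_eq line_sub) eqn_leq dimvS //= line1.
  move: hZ; rewrite -e => /vlineP[q qE].
  have m0 : (0 < m)%N by rewrite m2.
  have Zij i j : (Z i j)%:~R = q *+ (i == j).
    by move/matrixP: qE => /(_ i j); rewrite !mxE mulr_natr.
  have ZE : Z = (Z (Ordinal m0) (Ordinal m0))%:M.
    apply/matrixP => i j; rewrite mxE; apply: (@intr_inj rat).
    by rewrite Zij rmorphMn /= Zij eqxx mulr1n.
  apply: (Fk (Z (Ordinal m0) (Ordinal m0))).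
  by rewrite -[F]mul1mx -SP -mulmxA PF ZE -PS mulmxA SP mul1mx -ZE.
move=> dim2; have /subvPn[Z ZJ Zline] : ~~ (homV J J <= <[1%:M]>)%VS.
  by apply/negP => /dimvS; rewrite line1 leqNgt dim2.
have [D [Y [D0 YE]]] := clear_denominators Z.
have /homVP hY : Z *+ D \in homV J J by apply: rpredMn.
move: hY; rewrite YE => /(Qhom_hom EJ EJ)[F hF PF]; exists F => // k Fk.
case/negP: Zline; have YZ : Y^Z = (k%:M)^Z.
  by apply: (real_basis_inj EJ.1); rewrite -PF -PS Fk.
have Yk : Y = k%:M.
  by apply/matrixP => i j; move/matrixP: YZ => /(_ i j); rewrite [LHS]mxE [RHS]mxE => /intr_inj.
have : Z = D%:R^-1 *: (Z *+ D).
  by rewrite -scaler_nat scalerA mulVf ?scale1r // pnatr_eq0 -lt0n.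
rewrite YE Yk map_scalar_mx /= -scalemx1 scalerA => ->.
by rewrite memvZ ?memv_line.
Qed.

Section Isogeny.
Variables (g h : nat) (A : abvar R g) (B : abvar R h) (m n : nat).
Variables (J : 'M[R]_m) (P : 'M[C]_(m, g)) (J' : 'M[R]_n) (P' : 'M[C]_(n, h)).
Hypotheses (AJ : represents A J P) (BJ : represents B J' P').

Lemma lattice_coords (c : 'rV[R]_m) : lattice A (c^cx *m P) <-> exists z, c = z^Z.
Proof.
split=> [/(latticeP AJ)[z /(real_basis_inj AJ.1) ->]|[z ->]]; first by exists z.
by apply/(latticeP AJ); exists z.
Qed.

(* If y *m Z = 0 with y integral and y_j != 0, the points (k / (N y_j)) y,
   0 <= k < N, are pairwise distinct elements of the kernel. *)
Lemma finite_kernel_row_free F (Z : 'M[int]_(m, n)) (s : seq 'rV[C]_g) :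
  P *m F = Z^Z^cx *m P' ->
  (forall v, lattice B (v *m F) -> exists2 t, t \in s & lattice A (v - t)) ->
  row_free (map_mx intr Z : 'M[rat]_(m, n)).
Proof.
move=> PF sker; apply: inj_row_free => v vZ; apply/eqP/negP => /negP v0.
have [D [y [D0 yE]]] := clear_denominators v.
have yZ : y *m Z = 0.
  have : map_mx intr (y *m Z) = 0 :> 'M[rat]_(1, n).
    by rewrite map_mxM -yE -scaler_nat -scalemxAl vZ scaler0.
  move=> /matrixP e; apply/matrixP => i j; have := e i j; rewrite !mxE.
  by move/eqP; rewrite intr_eq0 => /eqP.
have [j yj0] : exists j, y 0 j != 0.
  apply/existsP; rewrite -negb_forall; apply: contraNN v0 => /forallP y0.
  have : v *+ D = 0 by rewrite yE; apply/matrixP => i j; rewrite ord1 !mxE (eqP (y0 j)).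
  by move/eqP; rewrite -scaler_nat scaler_eq0 pnatr_eq0 eqn0Ngt D0.
(* With one point more than [s] has elements, two of them share a representative in [s]. *)
pose N := (size s).+1.
pose c (k : nat) : 'rV[R]_m := (k%:R / (N%:R * (y 0 j)%:~R)) *: y^Z.
have cker k : lattice B ((c k)^cx *m P *m F).
  rewrite -mulmxA PF mulmxA -map_mxM /c -scalemxAl -map_mxM yZ.
  apply/(latticeP BJ); exists 0.
  by rewrite !map_mx0 scaler0 map_mx0 !mul0mx.
have /choice[t tP] k : exists t, t \in s /\ lattice A ((c k)^cx *m P - t).
  by have [t ts At] := sker _ (cker k); exists t.
have ilt (k : 'I_N) : (index (t k) s < size s)%N by rewrite index_mem (tP k).1.
have : injective (fun k : 'I_N => Ordinal (ilt k)).
  move=> k k' [ikk]; have tkk : t k = t k'.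
    by rewrite -(nth_index 0 (tP k).1) ikk nth_index // (tP k').1.
  have /lattice_coords[z zE] : lattice A ((c k - c k')^cx *m P).
    have [/(latticeP AJ)[z1 E1] /(latticeP AJ)[z2 E2]] := ((tP k).2, (tP k').2).
    apply/(latticeP AJ); exists (z1 - z2).
    rewrite map_mxB mulmxBl !map_mxB mulmxBl -E1 -E2 tkk.
    by rewrite opprB addrA subrK.
  have : ((k : nat)%:R - (k' : nat)%:R : R) = N%:R * (z 0 j)%:~R.
    move/matrixP/(_ 0 j): zE; rewrite !mxE => <-.
    field; rewrite ?intr_eq0 ?yj0 ?pnatr_eq0 //.
  rewrite -[X in X - _]/(((k : nat)%:Z)%:~R) -[X in _ - X]/(((k' : nat)%:Z)%:~R).
  rewrite -[N%:R]/((N%:Z)%:~R) -intrB -intrM => /intr_inj kk.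
  have kN := ltn_ord k; have kN' := ltn_ord k'.
  by apply: val_inj; apply: eq_of_diff_multiple kk.
by move=> /leq_card; rewrite !card_ord ltnn.
Qed.

(** If Z y^T = 0 with y integral and nonzero, pairing with y kills the image of F and is integral on
    the lattice of B, so a vector whose pairing with y is 1/2 is not reached. *)
Lemma surjective_row_full F (Z : 'M[int]_(m, n)) :
  P *m F = Z^Z^cx *m P' ->
  (forall w, exists v, lattice B (v *m F - w)) ->
  row_full (map_mx intr Z : 'M[rat]_(m, n)).
Proof.
move=> PF surj; rewrite /row_full -mxrank_tr -/(row_free _).
apply: inj_row_free => v vZ; apply/eqP/negP => /negP v0.
have [D [y [D0 yE]]] := clear_denominators v.
have yZ : Z *m y^T = 0.
  apply: trmx_inj; rewrite trmx_mul trmxK trmx0.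
  have : map_mx intr (y *m Z^T) = 0 :> 'M[rat]_(1, m).
    by rewrite map_mxM -yE -scaler_nat -scalemxAl -map_trmx vZ scaler0.
  move=> /matrixP e; apply/matrixP => i j; have := e i j; rewrite !mxE.
  by move/eqP; rewrite intr_eq0 => /eqP.
have [j yj0] : exists j, y 0 j != 0.
  apply/existsP; rewrite -negb_forall; apply: contraNN v0 => /forallP y0.
  have : v *+ D = 0 by rewrite yE; apply/matrixP => i j; rewrite ord1 !mxE (eqP (y0 j)).
  by move/eqP; rewrite -scaler_nat scaler_eq0 pnatr_eq0 eqn0Ngt D0.
pose c : 'rV[R]_n := (2 * (y 0 j)%:~R)^-1 *: delta_mx 0 j.
have cy : (c *m (y^T)^Z) 0 0 = 2^-1.
  rewrite /c -scalemxAl -rowE !mxE invfM mulfVK // intr_eq0 //.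
have [w] := surj (c^cx *m P'); have [f _ fK] := AJ.1.1; rewrite -[w]fK.
rewrite -mulmxA PF mulmxA -map_mxM -mulmxBl -map_mxB => /(latticeP BJ)[z].
move=> /(real_basis_inj BJ.1)/(congr1 (fun M => (M *m (y^T)^Z) 0 0)).
rewrite mulmxBl -mulmxA -map_mxM yZ map_mx0 mulmx0 sub0r -map_mxM mxE cy [RHS]mxE.
move: ((z *m y^T) 0 0) => a e.
have : (2 * a + 1)%:~R = 0 :> R by rewrite intrD intrM -e; lra.
by move/eqP; rewrite intr_eq0 => /eqP; lia.
Qed.

Lemma isogenous_Qisog : isogenous A B -> Qisog J J'.
Proof.
move=> [F [hF surj [s sker]]]; have [Z [PF ZJ]] := hom_lift AJ BJ hF.
exists (map_mx intr Z); split => //.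
  exact: finite_kernel_row_free PF sker.
exact: surjective_row_full PF surj.
Qed.

End Isogeny.

(** An integral multiple Y of Z defines F, and W = Y^-1 gives surjectivity. If N W is integral, the
    preimage of the lattice of B has coordinates in (1/N)Z, and division with remainder by N leaves
    finitely many classes modulo the lattice of A. *)
Lemma Qisog_isogenous g h (A : abvar R g) (B : abvar R h) m n
    (J : 'M[R]_m) P (J' : 'M[R]_n) P' :
  represents A J P -> represents B J' P' -> Qisog J J' -> isogenous A B.
Proof.
move=> AJ BJ JJ'; have e := Qisog_size JJ'; case: n / e J' P' BJ JJ' => J' P' BJ.
move=> [Z [ZJ]]; rewrite row_free_unit => Zu _.
have [D [Y [D0 YE]]] := clear_denominators Z.
have /homVP : Z *+ D \in homV J J' by apply/rpredMn/homVP.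
rewrite YE => /(Qhom_hom AJ BJ)[F hF PF].
have D0' : (D%:R : rat) != 0 by rewrite pnatr_eq0 -lt0n.
have Yu : (map_mx intr Y : 'M[rat]_m) \in unitmx.
  by rewrite -YE -scaler_nat unitmxZ // unitfE.
pose W := invmx (map_mx intr Y : 'M[rat]_m).
have YW : Y^Z *m W^R = 1%:M by rewrite -ratr_intmx -map_mxM mulmxV // map_mx1.
have WY : W^R *m Y^Z = 1%:M by rewrite -ratr_intmx -map_mxM mulVmx // map_mx1.
have [N [V [N0 VE]]] := clear_denominators W.
exists F; split => //.
  move=> w; have [f _ fK] := BJ.1.1; exists ((f w *m W^R)^cx *m P).
  rewrite -mulmxA PF mulmxA -map_mxM -mulmxA WY mulmx1 fK subrr.
  by apply/(latticeP BJ); exists 0; rewrite !map_mx0 mul0mx.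
pose pt (r : {ffun 'I_m -> 'I_N}) : 'rV[C]_g := (\row_j ((r j : nat)%:R / N%:R : R))^cx *m P.
exists (codom pt) => v.
have [f _ fK] := AJ.1.1; rewrite -[v]fK -mulmxA PF mulmxA -map_mxM.
move=> /(lattice_coords BJ)[z zE].
have cE : f v = z^Z *m W^R by rewrite -zE -mulmxA YW mulmx1.
have WV : W^R = N%:R^-1 *: V^Z.
  rewrite -ratr_intmx -VE -scaler_nat map_mxZ rmorph_nat scalerA mulVf ?scale1r //.
  by rewrite pnatr_eq0 -lt0n.
have [w wE] : exists w, w = z *m V by eexists.
pose y j : int := w 0 j.
have N0' : 0 < N%:Z :> int by rewrite ltz_nat.
have rlt j : (`|(y j %% N%:Z)%Z| < N)%N.
  by rewrite -ltz_nat gez0_abs ?modz_ge0 ?gt_eqF // ltz_pmod.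
exists (pt [ffun j => Ordinal (rlt j)]); first exact: codom_f.
rewrite -mulmxBl -map_mxB; apply/(lattice_coords AJ).
exists (\row_j (y j %/ N%:Z)%Z); apply/matrixP => i j.
rewrite ord1 cE WV -scalemxAr -map_mxM -wE !mxE ffunE /= -/(y j).
have NR : (N%:R : R) != 0 by rewrite pnatr_eq0 -lt0n.
have -> : (`|(y j %% N%:Z)%Z|%:R : R) = ((y j %% N%:Z)%Z)%:~R.
  by rewrite -[LHS]/((`|_|%:Z)%:~R) gez0_abs ?modz_ge0 ?gt_eqF.
rewrite {1}(divz_eq (y j) N%:Z) intrD intrM -[((N%:Z)%:~R : R)]/(N%:R : R).
by field.
Qed.

End Homomorphisms.

(** * Products, powers and the sets of Picard numbers *)

Section Products.
Variable R : realType.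
Local Notation C := R[i].

Lemma real_basis_block g h m n (J : 'M[R]_m) (P : 'M[C]_(m, g))
    (J' : 'M[R]_n) (P' : 'M[C]_(n, h)) :
  real_basis P J -> real_basis P' J' ->
  real_basis (block_mx P 0 0 P') (dsum J J').
Proof.
move=> [[p pK Kp] PI] [[q qK Kq] PI']; split; last first.
  rewrite /dsum map_block_mx !map_mx0 mulmx_block scale_block_mx.
  by rewrite !(mul0mx, mulmx0, addr0, add0r, scaler0) PI PI'.
exists (fun w => row_mx (p (lsubmx w)) (q (rsubmx w))) => c.
  rewrite -[c]hsubmxK map_row_mx mul_row_block !mulmx0 addr0 add0r.
  by rewrite row_mxKl row_mxKr pK qK.
rewrite map_row_mx mul_row_block !mulmx0 addr0 add0r.
by rewrite Kp Kq hsubmxK.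
Qed.

Lemma represents_prod g h (A : abvar R g) (B : abvar R h) m n
    (J : 'M[R]_m) P (J' : 'M[R]_n) P' :
  represents A J P -> represents B J' P' ->
  represents (abvar_prod A B) (dsum J J') (block_mx P 0 0 P').
Proof.
move=> AJ BJ; split; first exact: real_basis_block AJ.1 BJ.1.
rewrite /= AJ.2 BJ.2; apply/seteqP; split => w.
  move=> [[z _ zE] [t _ tE]]; exists (row_mx z t) => //.
  by rewrite map_row_mx mul_row_block !mulmx0 addr0 add0r zE tE hsubmxK.
move=> [c _ <-]; rewrite -[c]hsubmxK map_row_mx mul_row_block !mulmx0 addr0 add0r.
by split; rewrite /= ?row_mxKl ?row_mxKr; [exists (lsubmx c)|exists (rsubmx c)].
Qed.

Lemma represents_pow (E : abvar R 1) m (J : 'M[R]_m) P k :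
  represents E J P -> exists Q, represents (elliptic_pow E k) (dsum_pow J k) Q.
Proof.
move=> EJ; elim: k => [|k [Q IH]] /=; last first.
  by exists (block_mx P 0 0 Q); refine (represents_prod EJ IH).
exists 0; split; first split.
- by exists (fun=> 0) => v; rewrite ?[LHS]thinmx0 ?[RHS]thinmx0.
- by rewrite [LHS]thinmx0 [RHS]thinmx0.
by apply/seteqP; split => // v _; exists 0; rewrite // [RHS]thinmx0 mulmx0.
Qed.

Lemma represents_dim_ns_le g (A : abvar R g) m (J : 'M[R]_m) P :
  represents A J P -> (\dim (nsV J) <= g ^ 2)%N.
Proof.
move=> AJ; have mE := represents_size AJ; subst m.
apply: dim_ns_le_sqr (real_basis_cplx AJ.1) (represents_polarizable AJ).
Qed.

Lemma picard_numbers_le n x : picard_numbers R n x -> (x <= n ^ 2)%N.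
Proof.
case: n => [->//|n [A _ <-]]; have [m [J [P AJ]]] := ex_represents A.
by rewrite (picard_numberE AJ); apply: represents_dim_ns_le AJ.
Qed.

Lemma picard_numbers_dim n (A : abvar R n) m (J : 'M[R]_m) P :
  represents A J P -> picard_numbers R n (\dim (nsV J)).
Proof.
move=> AJ; case: n A P AJ => [|n] A P AJ.
  (* In dimension 0 the set is {0} by convention, and the bound by 0^2 leaves no other value. *)
  by have := represents_dim_ns_le AJ; rewrite leqn0 => /eqP ->.
by exists A => //; rewrite (picard_numberE AJ).
Qed.

End Products.

(** * Transfer of the equivalence from rational matrices to abelian varieties *)

Theorem corollary7p6 (R : realType) (l : nat) (hl : (0 < l)%N) :
  exists gl : nat, forall (g : nat), (gl <= g)%N ->
  forall (X : abvar R g) (n : nat), (n <= l)%N ->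
    shifted_picard_numbers R g n (picard_number X) <->
    exists (E : abvar R 1) (A : abvar R n),
      [/\ has_CM E,
          abvar_hom E A = [set 0] &
          isogenous X (abvar_prod (elliptic_pow E (g - n)) A)].
Proof.
exists (100 * (l + 1) ^ 2)%N => g gl X n nl.
have [m [J [P XJ]]] := ex_represents X.
have mE := represents_size XJ; subst m.
rewrite (picard_numberE XJ); split.
  (* As x <= n^2, the Picard number lies between (g - n)^2 and (g - n)^2 + n^2, the range handled by
     [large_ns_CM_split]. *)
  move=> [x /picard_numbers_le xn xE].
  have [|E [A [[EE Ep] Ecm [AA Ap] EA XEA]]] :=
      large_ns_CM_split gl nl (real_basis_cplx XJ.1) (represents_polarizable XJ).
    by rewrite -xE leq_addr leq_add2l.
  have [E' [Q EQ]] := @ex_abvar R 1 E EE Ep.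
  have [A' [S AS]] := ex_abvar AA Ap.
  have [T ET] := represents_pow (g - n) EQ.
  exists E', A'; split.
  - exact/(has_CM_dim EQ).
  - exact/(abvar_hom_eq0 EQ AS).
  - exact: Qisog_isogenous XJ (represents_prod ET AS) XEA.
move=> [E [A [Ecm EA XEA]]].
have [k [JE [Q EQ]]] := ex_represents E.
have kE := represents_size EQ; subst k.
have [k [JA [S AS]]] := ex_represents A.
have [T ET] := represents_pow (g - n) EQ.
have iso := isogenous_Qisog XJ (represents_prod ET AS) XEA.
exists (\dim (nsV JA)); first exact: picard_numbers_dim AS.
rewrite (dim_ns_isog iso) (@dim_ns_CM_split _ JE) //.
- exact: real_basis_cplx EQ.1.
- exact: represents_polarizable EQ.
- exact/(has_CM_dim EQ).
- exact: real_basis_cplx AS.1.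
- exact: represents_polarizable AS.
- exact/(abvar_hom_eq0 EQ AS).
Qed.
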